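(* Let $n>d$ and let $A=(a_{ij})$ be an $n\times d$ matrix of distinct noncommuting indeterminates, and let $D=K\langle\!( a_{ij})\!\rangle$ be the free skew field they generate. Let $f=f(a_{ij})\in D$ be a noncommutative rational function in the $a_{ij}$ that is invariant under all invertible transformations $A\mapsto A\cdot g$ with $g\in\mathrm{GL}_d(D)$ (i.e. $f(A\cdot g)=f(A)$ whenever the evaluation is defined). Then $f$ is a rational function of the quasi-Plücker coordinates $r_{ij}^M(A)$.
   Context: For a square matrix $B=(b_{ij})$, $B^{ij}$ denotes $B$ with row $i$ and column $j$ deleted, and the $(i,j)$-quasideterminant is $|B|_{ij}=b_{ij}-\xi(B^{ij})^{-1}\zeta$, where $\xi$ is row $i$ of $B$ without its $j$-th entry and $\zeta$ is column $j$ of $B$ without its $i$-th entry. For $S\subseteq[n]$ with $|S|=d$, $A_S$ is the $d\times d$ submatrix of $A$ with rows $S$. Quasi-Plücker coordinates: for $M\subseteq[n]$ with $|M|=d-1$, $i\notin M$, $j\in[n]$, $r_{ji}^M(A)=|A_{\{j\}\cup M}|_{js}\cdot|A_{\{i\}\cup M}|_{is}^{-1}$ for any $1\le s\le d$ (independent of $s$). *)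

(* Defs.v *)
From HB Require Import structures.
From mathcomp Require Import all_boot all_order all_algebra.
Set Implicit Arguments. Unset Strict Implicit. Unset Printing Implicit Defensive.
Import Order.TTheory GRing.Theory Num.Theory.
Local Open Scope ring_scope.

Inductive rexpr (K V : Type) : Type :=
| RVar of V
| RCst of K
| RAdd of rexpr K V & rexpr K V
| RNeg of rexpr K V
| RMul of rexpr K V & rexpr K V
| RInv of rexpr K V.

Fixpoint reval (K V : Type) (R : unitRingType) (iota : K -> R) (pt : V -> R)
  (e : rexpr K V) : option R :=
  match e with
  | RVar v => Some (pt v)
  | RCst c => Some (iota c)
  | RAdd e1 e2 =>
      match reval iota pt e1, reval iota pt e2 with
      | Some x, Some y => Some (x + y) | _, _ => None end
  | RNeg e1 => match reval iota pt e1 with Some x => Some (- x) | None => None end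
  | RMul e1 e2 =>
      match reval iota pt e1, reval iota pt e2 with
      | Some x, Some y => Some (x * y) | _, _ => None end
  | RInv e1 =>
      match reval iota pt e1 with
      | Some x => if x \is a GRing.unit then Some x^-1 else None
      | None => None end
  end.

Definition evalA (K : fieldType) (D : unitAlgType K) (V : Type) (pt : V -> D)
  (e : rexpr K V) : option D := reval (fun c : K => c%:A) pt e.

Definition Kt (K : fieldType) := {fraction {poly K}}.

Definition evalMx (K : fieldType) (m : nat) (V : Type)
  (pt : V -> 'M[Kt K]_m.+1) (e : rexpr K V) : option 'M[Kt K]_m.+1 :=
  reval (fun c : K => (tofrac (c%:P) : Kt K)%:M) pt e.

(* [free_field x] : D (a K-algebra, K central) is the free skew field
   K<( x )> generated by the family x, characterized via Amitsur's theorem: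
   D is a division ring, every element is the value of a rational expression in x,
   an expression is defined at x iff it is defined at some matrix point
   (over the infinite field K(t)), and a defined expression vanishes at x iff it
   vanishes at every matrix point where it is defined. *)
Definition free_field (K : fieldType) (D : unitAlgType K) (X : Type) (x : X -> D) : Prop :=
  [/\ forall u : D, u != 0 -> u \is a GRing.unit,
      forall u : D, exists e : rexpr K X, evalA x e = Some u,
      forall e : rexpr K X, evalA x e <> None <->
        exists (m : nat) (p : X -> 'M[Kt K]_m.+1), evalMx p e <> None
    & forall (e : rexpr K X) (u : D), evalA x e = Some u ->
        (u = 0 <-> forall (m : nat) (p : X -> 'M[Kt K]_m.+1) v,
                     evalMx p e = Some v -> v = 0)].

Definition Amx (R : Type) (n d : nat) (a : 'I_n * 'I_d -> R) : 'M[R]_(n, d) :=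
  \matrix_(i, j) a (i, j).

(* q is the quasideterminant |A_{{j} u M}|_{js}, where |M| = d-1:
   q = a_js - xi (A_{M, [d]\{s}})^{-1} zeta, with H the two-sided inverse of
   the square submatrix of A with rows M and columns [d] \ {s}. *)
Definition qdet_rel (D : unitRingType) (n d : nat) (a : 'I_n * 'I_d -> D)
  (M : {set 'I_n}) (j : 'I_n) (s : 'I_d) (q : D) : Prop :=
  exists H : 'I_d -> 'I_n -> D,
    [/\ forall l l' : 'I_d, l != s -> l' != s ->
          \sum_(k in M) H l k * a (k, l') = (l == l')%:R,
        forall k k' : 'I_n, k \in M -> k' \in M ->
          \sum_(l | l != s) a (k, l) * H l k' = (k == k')%:R
      & q = a (j, s) - \sum_(k in M) \sum_(l | l != s) a (j, l) * H l k * a (k, s)].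

(* r = r_{ji}^M(A) computed with column s. *)
Definition qplucker_rel (D : unitRingType) (n d : nat) (a : 'I_n * 'I_d -> D)
  (M : {set 'I_n}) (i j : 'I_n) (s : 'I_d) (r : D) : Prop :=
  exists qj qi : D,
    [/\ qdet_rel a M j s qj, qdet_rel a M i s qi, qi \is a GRing.unit
      & r = qj * qi^-1].

Definition qp_index (n d : nat) :=
  {t : {set 'I_n} * 'I_n * 'I_n | (#|t.1.1| == d.-1) && (t.1.2 \notin t.1.1)}.
Definition qpM n d (t : qp_index n d) : {set 'I_n} := (val t).1.1.
Definition qpi n d (t : qp_index n d) : 'I_n := (val t).1.2.
Definition qpj n d (t : qp_index n d) : 'I_n := (val t).2.

(* Main.v *)
(* With X the top d x d block of A and B = A X^-1, the entries of B are quasi-Pluecker coordinates, and invariance says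
   that f = e(B T) for every T in GL_d(D) at which the expression e for f is defined at B T; so it suffices to choose T over the
   skew field generated by the entries of B.
   If at least two entries b1, b2 of B lie below the identity block, take a matrix point (over K) where e is defined and
   deform b1 along E_00 and b2 along a cyclic shift, with parameter t.  Cayley-Hamilton for this rank one deformation
   gives chi(b1) = t rho(b1) with chi, rho over K, so t^i rho(b1)^J (i <= J) is a polynomial in b1 even when K is finite,
   and the elements b2^k t^i rho(b1)^J b2^l are enough to build T.
   If n = 2 and d = 1, D is generated by b and x.  Invariance, transported to matrices, shows that the value at (B, T)
   of the expression e lies in the bicommutant of B.  A matrix beta = B0 + (chi/rho)(b) E_00 over K(b), which has b as an eigenvalue
   with eigenvector xi over K(b), then satisfies e(beta, T0) xi = xi f with T0 over K, so f lies in K(b). *)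

Require Import Defs.
From HB Require Import structures.
From mathcomp Require Import all_boot all_order fingroup perm all_algebra.
Set Implicit Arguments. Unset Strict Implicit. Unset Printing Implicit Defensive.
Import GRing.Theory.
Local Open Scope ring_scope.

(** * Evaluation of rational expressions *)

(* Evaluation in an arbitrary ring, inverses being two-sided; needed for matrices over matrix rings, which carry no unit ring structure. *)
Section Ev.
Variables (K V : Type).

(** The obstacle is definedness. At [T = 1] the expression [e] may be undefined because [B] contains
    an identity block: for instance [e] may invert an entry that is zero there. When [n = 2] and
    [d = 1], moving [T] inside [K(b)] does not cure this: such a [T] commutes with [b], so an
    expression that inverts the commutator of the two variables is undefined at every [(T, b T)].
    Hence the separate argument for that case. Definedness in [D] is certified by matrix points, so
    [T] is sought as a matrix of expressions in [B] with good values at one such point. The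
    directions [E_00] and the cycle [C] are chosen because the products [C^k E_00 C^l] run through
    all matrix units; these are the leading terms in [t] of the words in [b1] and [b2], so the words
    span all matrices over [K(t)]. The coefficients are then moved to powers of [t], of which there
    are infinitely many even over a finite [K], and the factor [rho(b1)^J] absorbs these powers. A
    finite [K] is also why points over [K(t)] are brought down to [K] by substituting a companion
    matrix, not a scalar, for [t]. *)

Fixpoint ev (S : nzRingType) (io : K -> S) (pt : V -> S) (e : rexpr K V)
  : S -> Prop :=
  match e with
  | RVar v => fun w => w = pt v
  | RCst c => fun w => w = io c
  | RAdd e1 e2 => fun w =>
      exists x y, [/\ ev io pt e1 x, ev io pt e2 y & w = x + y]
  | RNeg e1 => fun w => exists2 x, ev io pt e1 x & w = - x
  | RMul e1 e2 => fun w =>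
      exists x y, [/\ ev io pt e1 x, ev io pt e2 y & w = x * y]
  | RInv e1 => fun w => exists x, [/\ ev io pt e1 x, x * w = 1 & w * x = 1]
  end.

Lemma inv_uniq (S : nzRingType) (x y z : S) : x * y = 1 -> z * x = 1 -> z = y.
Proof. by move=> xy zx; rewrite -[z]mulr1 -xy mulrA zx mul1r. Qed.

Lemma ev_fun (S : nzRingType) (io : K -> S) pt e w w' :
  ev io pt e w -> ev io pt e w' -> w = w'.
Proof.
elim: e w w' => [v|c|e1 IH1 e2 IH2|e1 IH1|e1 IH1 e2 IH2|e1 IH1] w w' /=.
- by move=> -> ->.
- by move=> -> ->.
- move=> [x [y [h1 h2 ->]]] [x' [y' [h1' h2' ->]]].
  by rewrite (IH1 _ _ h1 h1') (IH2 _ _ h2 h2').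
- by move=> [x h1 ->] [x' h1' ->]; rewrite (IH1 _ _ h1 h1').
- move=> [x [y [h1 h2 ->]]] [x' [y' [h1' h2' ->]]].
  by rewrite (IH1 _ _ h1 h1') (IH2 _ _ h2 h2').
- move=> [x [h1 xw wx]] [x' [h1' xw' wx']].
  by move: xw wx; rewrite (IH1 _ _ h1 h1') => xw wx; apply: inv_uniq xw' wx.
Qed.

Lemma revalP (S : unitRingType) (io : K -> S) pt e w :
  reval io pt e = Some w <-> ev io pt e w.
Proof.
elim: e w => [v|c|e1 IH1 e2 IH2|e1 IH1|e1 IH1 e2 IH2|e1 IH1] w /=.
- by split=> [[<-]|->].
- by split=> [[<-]|->].
- case E1: (reval io pt e1) => [x|]; last first.
    by split=> // -[x [y [/IH1 h1]]]; rewrite E1 in h1.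
  case E2: (reval io pt e2) => [y|]; last first.
    by split=> // -[x' [y [_ /IH2 h1]]]; rewrite E2 in h1.
  split=> [[<-]|[x' [y' [/IH1 h1 /IH2 h2 ->]]]].
    by exists x, y; split=> //; [apply/IH1|apply/IH2].
  by move: h1 h2; rewrite E1 E2 => -[->] [->].
- case E1: (reval io pt e1) => [x|]; last first.
    by split=> // -[x /IH1 h1]; rewrite E1 in h1.
  split=> [[<-]|[x' /IH1 h1 ->]]; first by exists x => //; apply/IH1.
  by move: h1; rewrite E1 => -[->].
- case E1: (reval io pt e1) => [x|]; last first.
    by split=> // -[x [y [/IH1 h1]]]; rewrite E1 in h1.
  case E2: (reval io pt e2) => [y|]; last first.
    by split=> // -[x' [y [_ /IH2 h1]]]; rewrite E2 in h1.
  split=> [[<-]|[x' [y' [/IH1 h1 /IH2 h2 ->]]]].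
    by exists x, y; split=> //; [apply/IH1|apply/IH2].
  by move: h1 h2; rewrite E1 E2 => -[->] [->].
- case E1: (reval io pt e1) => [x|]; last first.
    by split=> // -[x [/IH1 h1]]; rewrite E1 in h1.
  case: ifPn => [ux|nux]; last first.
    split=> // -[x' [/IH1]]; rewrite E1 => -[<-] h1 h2.
    by case/negP: nux; apply/unitrP; exists w.
  split=> [[<-]|[x' [/IH1]]].
    by exists x; rewrite mulrV // mulVr //; split=> //; apply/IH1.
  by rewrite E1 => -[<-] h1 h2; congr Some; apply: inv_uniq h1 (mulVr ux).
Qed.

Lemma ev_hom (S S' : nzRingType) (th : {rmorphism S -> S'}) (io : K -> S)
    (io' : K -> S') pt pt' e w :
  (forall c, io' c = th (io c)) -> (forall v, pt' v = th (pt v)) ->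
  ev io pt e w -> ev io' pt' e (th w).
Proof.
move=> hio hpt.
elim: e w => [v|c|e1 IH1 e2 IH2|e1 IH1|e1 IH1 e2 IH2|e1 IH1] w /=.
- by move=> ->.
- by move=> ->.
- move=> [x [y [h1 h2 ->]]]; exists (th x), (th y).
  by split; [exact: IH1|exact: IH2|rewrite rmorphD].
- by move=> [x h1 ->]; exists (th x); [exact: IH1|rewrite rmorphN].
- move=> [x [y [h1 h2 ->]]]; exists (th x), (th y).
  by split; [exact: IH1|exact: IH2|rewrite rmorphM].
- move=> [x [h1 h2 h3]]; exists (th x).
  by split; [exact: IH1|rewrite -rmorphM h2 rmorph1|rewrite -rmorphM h3 rmorph1].
Qed.

Lemma ev_conj (S : nzRingType) (io : K -> S) pt (g h : S) e w :
  (forall c, g * io c = io c * g) -> g * h = 1 -> h * g = 1 ->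
  ev io pt e w -> ev io (fun v => h * pt v * g) e (h * w * g).
Proof.
move=> hio gh hg.
elim: e w => [v|c|e1 IH1 e2 IH2|e1 IH1|e1 IH1 e2 IH2|e1 IH1] w /=.
- by move=> ->.
- by move=> ->; rewrite -mulrA -hio mulrA hg mul1r.
- move=> [x [y [h1 h2 ->]]]; exists (h * x * g), (h * y * g).
  by split; [exact: IH1|exact: IH2|rewrite mulrDr mulrDl].
- by move=> [x h1 ->]; exists (h * x * g); [exact: IH1|rewrite mulrN mulNr].
- move=> [x [y [h1 h2 ->]]]; exists (h * x * g), (h * y * g).
  split; [exact: IH1|exact: IH2|].
  by rewrite !mulrA -(mulrA _ g h) gh mulr1.
- move=> [x [h1 h2 h3]]; exists (h * x * g).
  split; first exact: IH1.
    by rewrite !mulrA -(mulrA _ g h) gh mulr1 -(mulrA h x w) h2 mulr1.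
  by rewrite !mulrA -(mulrA _ g h) gh mulr1 -(mulrA h w x) h3 mulr1.
Qed.

Lemma ev_ext (S : nzRingType) (io : K -> S) pt pt' e w :
  pt =1 pt' -> ev io pt e w -> ev io pt' e w.
Proof. by move=> h; apply: (ev_hom (th := idfun)) => // v; rewrite -h. Qed.

End Ev.

Fixpoint rsubst (K V W : Type) (s : V -> rexpr K W) (e : rexpr K V) : rexpr K W :=
  match e with
  | RVar v => s v
  | RCst c => RCst W c
  | RAdd e1 e2 => RAdd (rsubst s e1) (rsubst s e2)
  | RNeg e1 => RNeg (rsubst s e1)
  | RMul e1 e2 => RMul (rsubst s e1) (rsubst s e2)
  | RInv e1 => RInv (rsubst s e1)
  end.

Lemma ev_subst (K V W : Type) (S : nzRingType) (io : K -> S) (pt : W -> S)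
    (pt' : V -> S) s e w :
  (forall v, ev io pt (s v) (pt' v)) ->
  ev io pt' e w -> ev io pt (rsubst s e) w.
Proof.
move=> hs.
elim: e w => [v|c|e1 IH1 e2 IH2|e1 IH1|e1 IH1 e2 IH2|e1 IH1] w //=.
- by move=> ->.
- move=> [x [y [h1 h2 ->]]]; exists x, y.
  by split; [exact: IH1|exact: IH2|].
- by move=> [x h1 ->]; exists x; [exact: IH1|].
- move=> [x [y [h1 h2 ->]]]; exists x, y.
  by split; [exact: IH1|exact: IH2|].
- by move=> [x [h1 h2 h3]]; exists x; split=> //; exact: IH1.
Qed.

Lemma ev_substE (K V W : Type) (S : nzRingType) (io : K -> S) (pt : W -> S)
    (pt' : V -> S) s e w :
  (forall v, ev io pt (s v) (pt' v)) ->
  ev io pt (rsubst s e) w -> ev io pt' e w.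
Proof.
move=> hs.
elim: e w => [v|c|e1 IH1 e2 IH2|e1 IH1|e1 IH1 e2 IH2|e1 IH1] w //=.
- by move=> h; apply: ev_fun h (hs v).
- move=> [x [y [h1 h2 ->]]]; exists x, y.
  by split; [exact: IH1|exact: IH2|].
- by move=> [x h1 ->]; exists x; [exact: IH1|].
- move=> [x [y [h1 h2 ->]]]; exists x, y.
  by split; [exact: IH1|exact: IH2|].
- by move=> [x [h1 h2 h3]]; exists x; split=> //; exact: IH1.
Qed.

(** * Finite sums, polynomials and powers as rational expressions *)

Definition rsum (K : nzRingType) (V : Type) (I : finType) (P : pred I)
  (F : I -> rexpr K V) : rexpr K V :=
  \big[@RAdd K V/RCst V 0]_(i | P i) F i.

Lemma ev_rsum (K : nzRingType) (V : Type) (S : nzRingType)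
    (io : {rmorphism K -> S}) (pt : V -> S) (I : finType) (P : pred I) F f :
  (forall i, P i -> ev io pt (F i) (f i)) ->
  ev io pt (rsum P F) (\sum_(i | P i) f i).
Proof.
move=> h; rewrite /rsum unlock /= /reducebig.
elim: (index_enum I) => [|i s IH] /=; first by rewrite rmorph0.
by case: ifP => // Pi; exists (f i), (foldr (fun i x => if P i then f i + x else x) 0 s);
  split=> //; exact: h.
Qed.

Lemma ev_rsumE (K : nzRingType) (V : Type) (S : nzRingType)
    (io : {rmorphism K -> S}) (pt : V -> S) (I : finType) F w :
  ev io pt (rsum (fun _ : I => true) F) w ->
  forall i, exists v, ev io pt (F i) v.
Proof.
rewrite /rsum unlock /= /reducebig => h i; have: i \in index_enum I by exact: mem_index_enum.
elim: (index_enum I) w h => [|j s IH] //= w [x [y [h1 h2 _]]].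
by rewrite in_cons => /orP[/eqP ->|/(IH _ h2)] //; exists x.
Qed.

(* Horner scheme, so that no commutation between the value of [e] and the constants is needed. *)
Definition rpoly (K V : Type) (p : seq K) (e : rexpr K V) (z : K) : rexpr K V :=
  foldr (fun c r => RAdd (RMul r e) (RCst V c)) (RCst V z) p.

Lemma ev_rpoly (K : nzRingType) (V : Type) (S : nzRingType)
    (io : {rmorphism K -> S}) (pt : V -> S) (p : {poly K}) e x :
  ev io pt e x -> ev io pt (rpoly p e 0) (map_poly io p).[x].
Proof.
move=> he; rewrite /rpoly map_polyE.
have -> : (Poly (map io p)).[x] = horner_rec (map io p) x.
  elim: (polyseq p) => [|c s IH] /=; first by rewrite horner0.
  by rewrite horner_cons IH.
elim: (polyseq p) => [|c s IH] /=; first by rewrite rmorph0.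
exists (horner_rec [seq io i | i <- s] x * x), (io c).
by split=> //; exists (horner_rec [seq io i | i <- s] x), x.
Qed.

Fixpoint rexp (K : nzRingType) (V : Type) (e : rexpr K V) (n : nat) : rexpr K V :=
  if n is n'.+1 then RMul e (rexp e n') else RCst V 1.

Lemma ev_rexp (K : nzRingType) (V : Type) (S : nzRingType)
    (io : {rmorphism K -> S}) (pt : V -> S) e x n :
  ev io pt e x -> ev io pt (rexp e n) (x ^+ n).
Proof.
move=> he; elim: n => [|n IH] /=; first by rewrite rmorph1.
by exists x, (x ^+ n); rewrite exprS.
Qed.

(** * Common denominators of values at matrix points *)

Section NumDen.
Variables (K : nzRingType) (V : Type) (m : nat).

(** A value is represented as a matrix [N] over a central scalar [q], where the point itself is
    [P v / de]. Nothing is cancelled: the inverse of [N / q] is written [q^2 adj N / (q det N)], so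
    the final denominator is a multiple of every intermediate one and its invertibility makes all
    subexpressions defined. *)
Fixpoint numden (A : comNzRingType) (io : K -> A) (P : V -> 'M[A]_m.+1)
  (de : A) (e : rexpr K V) : 'M[A]_m.+1 * A :=
  match e with
  | RVar v => (P v, de)
  | RCst c => ((io c)%:M, 1)
  | RAdd e1 e2 =>
      let: (N1, q1) := numden io P de e1 in
      let: (N2, q2) := numden io P de e2 in (q2 *: N1 + q1 *: N2, q1 * q2)
  | RNeg e1 => let: (N1, q1) := numden io P de e1 in (- N1, q1)
  | RMul e1 e2 =>
      let: (N1, q1) := numden io P de e1 in
      let: (N2, q2) := numden io P de e2 in (N1 * N2, q1 * q2)
  | RInv e1 =>
      let: (N1, q1) := numden io P de e1 in (q1 ^+ 2 *: \adj N1, q1 * \det N1)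
  end.

Definition is_inv (S : nzRingType) (x : S) := exists u, x * u = 1 /\ u * x = 1.

Lemma is_inv_cancel (S : nzRingType) (x y z : S) :
  is_inv x -> x * y = x * z -> y = z.
Proof.
by move=> [u [_ ux]] /(congr1 (fun w => u * w)); rewrite !mulrA ux !mul1r.
Qed.

Lemma is_inv_comm (S : nzRingType) (x y : S) :
  x * y = y * x -> is_inv (x * y) -> is_inv x.
Proof.
move=> xy [u [h1 h2]]; exists (y * u); rewrite mulrA h1; split=> //.
have <- : u * y = y * u; last by rewrite -mulrA -xy.
have i : is_inv (x * y) by exists u.
apply: (is_inv_cancel i); rewrite mulrA h1 mul1r {1}xy -mulrA (mulrA x) h1.
by rewrite mulr1.
Qed.

(** [th] is arbitrary because it is used as the identity, as the substitution of a matrix for a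
    variable, and as such a substitution followed by flattening. The point in [S] is pinned down
    only by [th(de) * pS v = th(P v)]. *)
Lemma numden_spec (A : comNzRingType) (io : K -> A) P de (S : nzRingType)
    (th : {rmorphism 'M[A]_m.+1 -> S}) (iS : K -> S) (pS : V -> S) e :
  (forall c, iS c = th (io c)%:M) ->
  (forall v, th de%:M * pS v = th (P v)) ->
  is_inv (th (numden io P de e).2%:M) ->
  exists2 w, ev iS pS e w & th (numden io P de e).2%:M * w = th (numden io P de e).1.
Proof.
move=> hi hp.
have cen (a : A) X : th a%:M * th X = th X * th a%:M.
  by rewrite -!rmorphM; congr (th _); exact: comm_scalar_mx.
have thZ a X : th (a *: X) = th a%:M * th X.
  by rewrite -rmorphM /=; congr (th _); rewrite -mul_scalar_mx.
have thM a b : th (a * b)%:M = th a%:M * th b%:M.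
  by rewrite -rmorphM /=; congr (th _); exact: scalar_mxM.
(* A value need not lie in the image of [th], but once an invertible scalar multiple of it does, it
   commutes with all scalars. *)
have cenx (q a : A) X x : is_inv (th q%:M) -> th q%:M * x = th X ->
    th a%:M * x = x * th a%:M.
  move=> iq hx; apply: (is_inv_cancel iq).
  by rewrite mulrA cen -mulrA hx cen -hx mulrA.
elim: e => [v|c|e1 IH1 e2 IH2|e1 IH1|e1 IH1 e2 IH2|e1 IH1] /=.
- by move=> _; exists (pS v).
- by move=> _; exists (iS c) => //; rewrite rmorph1 mul1r.
- move: IH1 IH2; case: (numden _ _ _ e1) => N1 q1; case: (numden _ _ _ e2) => N2 q2 /=.
  rewrite thM => IH1 IH2 i.
  case: IH1 => [|x hx xN]; first exact: is_inv_comm (cen _ _) i.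
  case: IH2 => [|y hy yN]; first by rewrite cen in i; exact: is_inv_comm (cen _ _) i.
  exists (x + y); first by exists x, y.
  rewrite mulrDr rmorphD !thZ; congr (_ + _); last by rewrite -mulrA yN.
  by rewrite cen -mulrA xN.
- move: IH1; case: (numden _ _ _ e1) => N1 q1 /= IH1 /IH1[x hx xN].
  by exists (- x); [exists x|rewrite mulrN rmorphN xN].
- move: IH1 IH2; case: (numden _ _ _ e1) => N1 q1; case: (numden _ _ _ e2) => N2 q2 /=.
  rewrite thM => IH1 IH2 i.
  case: IH1 => [|x hx xN]; first exact: is_inv_comm (cen _ _) i.
  case: IH2 => [|y hy yN]; first by rewrite cen in i; exact: is_inv_comm (cen _ _) i.
  exists (x * y); first by exists x, y.
  by rewrite cen -mulrA (mulrA _ x) xN mulrA cen -mulrA yN rmorphM.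
- move: IH1; case: (numden _ _ _ e1) => N1 q1 /= IH1.
  rewrite thM => i.
  have i1 : is_inv (th q1%:M) by exact: is_inv_comm (cen _ _) i.
  case: (IH1 i1) => x hx xN.
  have [u [h1 h2]] := i.
  have cx a := cenx _ a _ _ i1 xN.
  have cw : th q1%:M * th (\det N1)%:M * (u * th (q1 ^+ 2 *: \adj N1)) = th (q1 ^+ 2 *: \adj N1).
    by rewrite mulrA h1 mul1r.
  exists (u * th (q1 ^+ 2 *: \adj N1)) => //.
  have adjr : th N1 * th (\adj N1) = th (\det N1)%:M.
    by rewrite -rmorphM; congr (th _); exact: mul_mx_adj.
  have adjl : th (\adj N1) * th N1 = th (\det N1)%:M.
    by rewrite -rmorphM; congr (th _); exact: mul_adj_mx.
  exists x; split=> //; apply: (is_inv_cancel i); rewrite mulr1.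
    rewrite mulrA -thM cx thM -mulrA cw thZ expr2 thM.
    by rewrite !mulrA -cx xN -(cen q1 N1) -mulrA adjr.
  rewrite mulrA cw thZ expr2 thM -!mulrA; congr (_ * _).
  by rewrite mulrA cen -mulrA xN adjl.
Qed.

Lemma numden_map (A A' : comNzRingType) (f : {rmorphism A -> A'})
    (io : K -> A) (io' : K -> A') P P' de de' e :
  (forall c, io' c = f (io c)) -> (forall v, P' v = map_mx f (P v)) ->
  de' = f de ->
  numden io' P' de' e = (map_mx f (numden io P de e).1, f (numden io P de e).2).
Proof.
move=> hi hp ->.
elim: e => [v|c|e1 IH1 e2 IH2|e1 IH1|e1 IH1 e2 IH2|e1 IH1] /=.
- by rewrite hp.
- by rewrite hi map_scalar_mx rmorph1.
- rewrite IH1 IH2; case: (numden _ _ _ e1) => N1 q1; case: (numden _ _ _ e2) => N2 q2 /=.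
  by rewrite map_mxD !map_mxZ rmorphM.
- by rewrite IH1; case: (numden _ _ _ e1) => N1 q1 /=; rewrite map_mxN.
- rewrite IH1 IH2; case: (numden _ _ _ e1) => N1 q1; case: (numden _ _ _ e2) => N2 q2 /=.
  by rewrite -[N1 * N2]/(N1 *m N2) map_mxM rmorphM.
- rewrite IH1; case: (numden _ _ _ e1) => N1 q1 /=.
  by rewrite map_mxZ map_mx_adj !expr2 !rmorphM det_map_mx.
Qed.

Lemma scalar_is_inv (F : fieldType) (q : F) :
  q != 0 -> is_inv (q%:M : 'M[F]_m.+1).
Proof.
move=> q0; exists (q^-1)%:M; split.
  by rewrite -[LHS]/(_ *m _) -scalar_mxM mulfV.
by rewrite -[LHS]/(_ *m _) -scalar_mxM mulVf.
Qed.

(** Over a field no intermediate denominator vanishes where the expression is defined: at an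
    inverse, the value [N1 / q1] is invertible, which forces [det N1 != 0]. *)
Lemma numden_def (F : fieldType) (io : K -> F) (P : V -> 'M[F]_m.+1) de e :
  de != 0 -> (exists w, ev (fun c => (io c)%:M) (fun v => de^-1 *: P v) e w) ->
  (numden io P de e).2 != 0.
Proof.
move=> d0; pose pt v := de^-1 *: P v.
have spec e' : (numden io P de e').2 != 0 ->
   exists2 w, ev (fun c => (io c)%:M) pt e' w & (numden io P de e').2%:M * w = (numden io P de e').1.
  move=> h; apply: (@numden_spec _ io P de _ idfun) => //=; last exact: scalar_is_inv.
  by move=> v; rewrite -[LHS]/(_ *m _) mul_scalar_mx scalerA mulfV // scale1r.
elim: e => [v|c|e1 IH1 e2 IH2|e1 IH1|e1 IH1 e2 IH2|e1 IH1] //=; rewrite ?oner_eq0 //.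
- move: IH1 IH2; case: (numden _ _ _ e1) => N1 q1; case: (numden _ _ _ e2) => N2 q2 /=.
  move=> IH1 IH2 [w [x [y [h1 h2 _]]]]; rewrite mulf_neq0 //; [apply: IH1|apply: IH2].
    by exists x.
  by exists y.
- move: IH1; case: (numden _ _ _ e1) => N1 q1 /= IH1 [w [x h1 _]]; apply: IH1.
  by exists x.
- move: IH1 IH2; case: (numden _ _ _ e1) => N1 q1; case: (numden _ _ _ e2) => N2 q2 /=.
  move=> IH1 IH2 [w [x [y [h1 h2 _]]]]; rewrite mulf_neq0 //; [apply: IH1|apply: IH2].
    by exists x.
  by exists y.
- move: IH1 (spec e1); case: (numden _ _ _ e1) => N1 q1 /= IH1 spec1 [w [x [h1 xw wx]]].
  have q0 : q1 != 0 by apply: IH1; exists x.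
  have [x' hx' xN] := spec1 q0.
  rewrite mulf_neq0 // -xN (ev_fun hx' h1) -[_ * x]/(_ *m x) mul_scalar_mx detZ.
  rewrite mulf_neq0 ?expf_neq0 //; apply/eqP => dx.
  have := congr1 determinant xw; rewrite -[x * w]/(x *m w) det_mulmx dx mul0r.
  by rewrite det1 => /esym/eqP; rewrite oner_eq0.
Qed.

(** Definedness at a matrix point thus becomes the non-vanishing of a single element, polynomial in
    the entries of the point. *)
Lemma numdenP (F : fieldType) (io : K -> F) (P : V -> 'M[F]_m.+1) e :
  (exists w, ev (fun c => (io c)%:M) P e w) <-> (numden io P 1 e).2 != 0.
Proof.
split=> [[w h]|h].
  apply: numden_def; first exact: oner_neq0.
  by exists w; apply: ev_ext h => v; rewrite invr1 scale1r.
have [] // := @numden_spec _ io P 1 _ idfun (fun c => (io c)%:M) P e.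
- by move=> v; rewrite /= mul1r.
- exact: scalar_is_inv.
- by move=> w hw _; exists w.
Qed.

End NumDen.

(** * From matrix points over K(t) to matrix points over K *)

Section Flat.
Variables (R : nzRingType) (m r : nat).
(** The predecessor of [(m+1)(r+1)], since the matrix rings here are indexed by a successor. *)
Definition flat_dim := (r + m * r.+1)%N.

Lemma flat_dimE : flat_dim.+1 = #|{: 'I_m.+1 * 'I_r.+1}|.
Proof. by rewrite card_prod !card_ord. Qed.

Definition flat_pair (k : 'I_flat_dim.+1) : 'I_m.+1 * 'I_r.+1 :=
  enum_val (cast_ord flat_dimE k).

Definition flat_index (x : 'I_m.+1 * 'I_r.+1) : 'I_flat_dim.+1 :=
  cast_ord (esym flat_dimE) (enum_rank x).

Lemma flat_indexK : cancel flat_index flat_pair.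
Proof. by move=> x; rewrite /flat_pair cast_ordKV enum_rankK. Qed.

Lemma flat_pairK : cancel flat_pair flat_index.
Proof. by move=> k; rewrite /flat_index enum_valK cast_ordK. Qed.

Definition flatmx (A : 'M['M[R]_r.+1]_m.+1) : 'M[R]_flat_dim.+1 :=
  \matrix_(i, j) A (flat_pair i).1 (flat_pair j).1 (flat_pair i).2 (flat_pair j).2.

Lemma flatmx_is_zmod_morphism : zmod_morphism flatmx.
Proof. by move=> A B; apply/matrixP=> i j; rewrite !mxE. Qed.

Lemma flatmx_is_monoid_morphism : monoid_morphism flatmx.
Proof.
split=> [|A B]; apply/matrixP=> i j; rewrite !mxE.
  rewrite -(inj_eq (can_inj flat_pairK) i j).
  case: (flat_pair i) (flat_pair j) => [i1 i2] [j1 j2] /=.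
  by rewrite xpair_eqE; case: (i1 =P j1) => _ /=; rewrite !mxE.
rewrite summxE.
under eq_bigr do rewrite mxE.
under [RHS]eq_bigr do rewrite !mxE.
rewrite [RHS](reindex flat_index) /=; last first.
  by exists flat_pair => x _; [exact: flat_indexK|exact: flat_pairK].
under [RHS]eq_bigr do rewrite flat_indexK.
by rewrite pair_bigA.
Qed.

HB.instance Definition _ :=
  GRing.isZmodMorphism.Build _ _ flatmx flatmx_is_zmod_morphism.
HB.instance Definition _ :=
  GRing.isMonoidMorphism.Build _ _ flatmx flatmx_is_monoid_morphism.

Lemma flatmx_inj : injective flatmx.
Proof.
move=> A B /matrixP h; apply/matrixP=> i j; apply/matrixP=> k l.
by move: (h (flat_index (i, k)) (flat_index (j, l))); rewrite !mxE !flat_indexK.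
Qed.

Lemma flatmx_scalar (c : R) : flatmx (c%:M)%:M = c%:M.
Proof.
apply/matrixP=> i j; rewrite !mxE -(inj_eq (can_inj flat_pairK) i j).
case: (flat_pair i) (flat_pair j) => [i1 i2] [j1 j2] /=.
by rewrite xpair_eqE; case: (i1 =P j1) => _ /=; rewrite !mxE.
Qed.

End Flat.

(** * Degree bounds for numerators and denominators *)

Section Degree.
Variables (K L : fieldType) (V : Type) (m : nat).

Lemma size_poly_mul_bound (p q : {poly L}) a b :
  (size p <= a)%N -> (size q <= b)%N -> (size (p * q)%R <= a + b)%N.
Proof.
move=> pa qb; apply: leq_trans (size_polyMleq p q) _.
by apply: leq_trans (leq_pred _) _; apply: leq_add.
Qed.

Lemma size_poly_sum_bound (I : finType) (F : I -> {poly L}) a :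
  (forall i, size (F i) <= a)%N -> (size (\sum_i F i)%R <= a)%N.
Proof. by move=> h; apply: leq_trans (size_sum _ _ _) _; apply/bigmax_leqP. Qed.

Lemma size_det_bound n (A : 'M[{poly L}]_n) a :
  (forall i j, size (A i j) <= a)%N -> (size (\det A) <= (n * a).+1)%N.
Proof.
move=> h; rewrite /determinant; apply: size_poly_sum_bound => s.
rewrite -signr_odd mulr_sign.
have b : (size (\prod_i A i (s i))%R <= (n * a).+1)%N.
  apply: leq_trans (size_prod_leq _ _) _.
  apply: leq_trans (leq_subr _ _) _; rewrite ltnS.
  by apply: leq_trans (leq_sum _ (fun i _ => h i (s i))) _; rewrite sum_nat_const card_ord.
by case: ifP => _; rewrite ?size_polyN.
Qed.

(** The bound depends on [e] and [m] only and is uniform over all points whose entries have degree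
    at most 1. This uniformity lets it be fixed before the point is chosen. *)
Lemma numden_size (e : rexpr K V) : exists b, forall (io : K -> {poly L}) (P : V -> 'M[{poly L}]_m.+1),
  (forall c, size (io c) <= 1)%N ->
  (forall v i j, size (P v i j) <= 2)%N ->
  (size (numden io P 1 e).2 <= b)%N /\
  forall i j, (size ((numden io P 1 e).1 i j) <= b)%N.
Proof.
have sD (p q : {poly L}) a b : (size p <= a)%N -> (size q <= b)%N ->
    (size (p + q)%R <= a + b)%N.
  move=> pa qb; apply: leq_trans (size_polyD p q) _.
  by rewrite geq_max (leq_trans pa (leq_addr _ _)) (leq_trans qb (leq_addl _ _)).
elim: e => [v|c|e1 [b1 IH1] e2 [b2 IH2]|e1 [b1 IH1]|e1 [b1 IH1] e2 [b2 IH2]|e1 [b1 IH1]].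
- by exists 2 => io P hi hp /=; rewrite size_poly1.
- exists 1%N => io P hi hp /=; rewrite size_poly1; split=> // i j.
  by rewrite mxE; case: (i == j); rewrite ?mulr1n ?mulr0n ?size_poly0.
- exists (b2 + b1 + (b1 + b2))%N => io P hi hp /=.
  move: (IH1 io P hi hp) (IH2 io P hi hp).
  case: (numden _ _ _ e1) => N1 q1; case: (numden _ _ _ e2) => N2 q2 /= [h1 h1'] [h2 h2'].
  split; first exact: leq_trans (size_poly_mul_bound h1 h2) (leq_addl _ _).
  by move=> i j; rewrite !mxE; apply: sD; apply: size_poly_mul_bound.
- exists b1 => io P hi hp /=; move: (IH1 io P hi hp).
  case: (numden _ _ _ e1) => N1 q1 /= [h1 h1'].
  by split=> // i j; rewrite mxE size_polyN.
- exists (b1 + b2)%N => io P hi hp /=.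
  move: (IH1 io P hi hp) (IH2 io P hi hp).
  case: (numden _ _ _ e1) => N1 q1; case: (numden _ _ _ e2) => N2 q2 /= [h1 h1'] [h2 h2'].
  split; first exact: size_poly_mul_bound.
  by move=> i j; rewrite mxE; apply: size_poly_sum_bound => k; apply: size_poly_mul_bound.
- exists (b1 + (m.+1 * b1).+1 + (b1 + b1 + (m * b1).+1))%N => io P hi hp /=.
  move: (IH1 io P hi hp); case: (numden _ _ _ e1) => N1 q1 /= [h1 h1'].
  split.
    apply: leq_trans (leq_addr _ _); apply: size_poly_mul_bound => //.
    exact: size_det_bound.
  move=> i j; rewrite !mxE; apply: leq_trans (leq_addl _ _).
  apply: size_poly_mul_bound; first exact: size_poly_mul_bound.
  rewrite /cofactor -signr_odd mulr_sign.
  have b : (size (\det (row' j (col' i N1))) <= (m * b1).+1)%N.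
    by apply: size_det_bound => i' j'; rewrite !mxE.
  by case: ifP => _; rewrite ?size_polyN.
Qed.

End Degree.

(** * Clearing denominators and replacing the variable by a matrix *)

Lemma fraction_numden (R : idomainType) (x : {fraction R}) :
  exists n d : R, d != 0 /\ x = tofrac n / tofrac d.
Proof.
pose r := generic_quotient.repr x; exists (frac r).1, (frac r).2.
have d0 : (frac r).2 != 0 := denom_ratioP r.
split=> //; apply: (canRL (mulfK _)); first by rewrite tofrac_eq0.
rewrite -[x]reprK -/r; unlock tofrac.
rewrite -[LHS]FracField.pi_mul; apply/eqmodP; rewrite /= FracField.equivfE /FracField.mulf.
by rewrite !numden_Ratio ?oner_neq0 ?mulr1 ?mulf_neq0 ?oner_neq0 // mulrC.
Qed.

Lemma common_denom (R : idomainType) (I : finType) (x : I -> {fraction R}) :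
  exists (d : R) (n : I -> R), d != 0 /\ forall i, x i = (tofrac d)^-1 * tofrac (n i).
Proof.
have /fin_all_exists [n hn] := fun i => fraction_numden (x i).
have /fin_all_exists [d hd] := hn.
exists (\prod_i d i), (fun i => n i * \prod_(j | j != i) d j).
have dj j : d j != 0 by case: (hd j).
split=> [|i]; first by apply/prodf_neq0.
have [di ->] := hd i.
have nz : tofrac (\prod_(j | j != i) d j) != 0.
  by rewrite tofrac_eq0; apply/prodf_neq0.
rewrite [in RHS](bigD1 i) //= !tofracM invfM mulrC -mulrA; congr (_ * _).
by rewrite mulrCA mulVf // mulr1.
Qed.

(* The companion matrix of a polynomial of the form [X q + c] is a root of a polynomial coprime to [q]. *)
Lemma poly_matrix_unit (K : fieldType) (q : {poly K}) : q != 0 ->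
  exists (r : nat) (C : 'M[K]_r.+1), is_inv (horner_mx C q).
Proof.
move=> q0; pose l := (lead_coef q)^-1.
have l0 : l != 0 by rewrite invr_eq0 lead_coef_eq0.
pose p := l *: q * 'X + 1%:P.
have sp : size p = (size q).+1.
  by rewrite size_MXaddC size_scale // scaler_eq0 (negPf l0) (negPf q0).
have pm : p \is monic.
  rewrite monicE lead_coefE sp /= coefD coefC coefMX coefZ.
  have sq : (0 < size q)%N by rewrite size_poly_gt0.
  by rewrite -(prednK sq) /= addr0 -lead_coefE mulVf // lead_coef_eq0.
have [r rE] : exists r, (size p).-1 = r.+1.
  by exists (size q).-1; rewrite sp /= prednK // size_poly_gt0.
have := companionmxK pm; move: (companionmx p); rewrite rE => C hC.
(* [p(C) = 0] reads [l q(C) C = -1], so [- l C] inverts [q(C)]. *)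
exists r, C, (horner_mx C (- l *: 'X)).
have h : horner_mx C (- l *: 'X * q) = 1.
  have : horner_mx C p = 0 by rewrite -hC Cayley_Hamilton.
  rewrite /p rmorphD /= horner_mx_C => /eqP; rewrite addr_eq0 => /eqP h.
  have -> : - l *: 'X * q = - (l *: q * 'X).
    by rewrite scaleNr mulNr -!scalerAl ['X * q]mulrC.
  by rewrite rmorphN /= h opprK.
by split; rewrite -rmorphM /= -?h // mulrC.
Qed.

Lemma is_inv_hom (S S' : nzRingType) (f : {rmorphism S -> S'}) x :
  is_inv x -> is_inv (f x).
Proof.
by move=> [u [h1 h2]]; exists (f u); rewrite -!rmorphM h1 h2 rmorph1.
Qed.

Definition frac_const (K : fieldType) : K -> Kt K := fun c => tofrac c%:P.
HB.instance Definition _ (K : fieldType) := GRing.RMorphism.copy (@frac_const K)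
  (@FracField.tofrac _ \o @polyC K).

Section SpecializeT.
Variables (K : fieldType) (V : finType).

Lemma evalMxP (m : nat) (p : V -> 'M[Kt K]_m.+1) (e : rexpr K V) w :
  evalMx p e = Some w <-> ev (fun c => (frac_const c)%:M) p e w.
Proof. exact: revalP. Qed.

(** A finite [K] may have no element at which the denominators survive. A companion matrix [C] is
    substituted for [t] instead, and the resulting matrix of matrices is flattened, at the cost of a
    larger dimension. *)
Lemma specialize_point (m : nat) (p : V -> 'M[Kt K]_m.+1) (e : rexpr K V) w :
  ev (fun c => (frac_const c)%:M) p e w ->
  exists (m' : nat) (p' : V -> 'M[K]_m'.+1) w', ev (fun c => c%:M) p' e w'.
Proof.
move=> h.
have [d [n [d0 hn]]] := common_denom (fun x : V * 'I_m.+1 * 'I_m.+1 => p x.1.1 x.1.2 x.2).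
pose P v : 'M[{poly K}]_m.+1 := \matrix_(i, j) n (v, i, j).
pose q := (numden (@polyC K) P d e).2.
have q0 : q != 0.
  rewrite -tofrac_eq0.
  have := numden_map (f := @FracField.tofrac {poly K}) (io := @polyC K)
    (io' := @frac_const K) (P := P) e (fun=> erefl) (fun=> erefl) erefl (de := d).
  move=> /(congr1 snd) /= <-.
  apply: numden_def; first by rewrite tofrac_eq0.
  exists w; apply: ev_ext h => v; apply/matrixP=> i j.
  by rewrite !mxE (hn (v, i, j)).
(* [C] keeps invertible both the denominator [q] of the expression and the common denominator [d] of
   the entries of the point. *)
have [r [C hC]] : exists (r : nat) (C : 'M[K]_r.+1), is_inv (horner_mx C (q * d)).
  by apply: poly_matrix_unit; rewrite mulf_neq0.
pose th := @flatmx K m r \o map_mx (horner_mx C).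
have thE x : th x%:M = flatmx (horner_mx C x)%:M.
  by rewrite /th /= map_scalar_mx.
have hC2 := is_inv_hom (@flatmx K m r \o @scalar_mx 'M[K]_r.+1 m.+1) hC.
have thM x y : th (x * y)%:M = th x%:M * th y%:M.
  by rewrite -rmorphM; congr (th _); exact: scalar_mxM.
have hqd : is_inv (th q%:M * th d%:M) by rewrite -thM /th /= map_scalar_mx.
have cqd : th q%:M * th d%:M = th d%:M * th q%:M by rewrite -!thM mulrC.
have hq := is_inv_comm cqd hqd.
have hd : is_inv (th d%:M) by rewrite cqd in hqd; exact: is_inv_comm (esym cqd) hqd.
have [u [du ud]] := hd.
have [] // := @numden_spec _ _ _ _ (@polyC K) P d _ th (fun c => c%:M) (fun v => u * th (P v)) e.
- by move=> c; have := thE c%:P; rewrite horner_mx_C flatmx_scalar => <-.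
- by move=> v; rewrite mulrA du mul1r.
- by move=> w' hw' _; exists _, (fun v => u * th (P v)), w'.
Qed.

End SpecializeT.

(** * Transfer between the free skew field and matrix points *)

Section FreeField.
Variables (K : fieldType) (V : finType) (D : unitAlgType K) (a : V -> D).
Hypothesis ffa : free_field a.

Lemma free_field_inv (u : D) : u != 0 -> is_inv u.
Proof.
by have [h _ _ _] := ffa => /h uu; exists u^-1; rewrite mulrV // mulVr.
Qed.

Lemma free_field_gen (u : D) : exists e, ev (in_alg D) a e u.
Proof. by have [_ h _ _] := ffa; have [e /revalP he] := h u; exists e. Qed.

Lemma free_field_point (e : rexpr K V) u : ev (in_alg D) a e u ->
  exists (m : nat) (p : V -> 'M[K]_m.+1) w, ev (fun c => c%:M) p e w.
Proof.
move=> /revalP hu; have [_ _ /(_ e) [+ _] _] := ffa.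
rewrite /evalA hu => -[] // m [p hp].
case E: (evalMx p e) hp => [w|//] _.
by move/evalMxP: E => /specialize_point.
Qed.

Lemma free_field_def (m : nat) (p : V -> 'M[Kt K]_m.+1) (e : rexpr K V) w :
  ev (fun c => (frac_const c)%:M) p e w -> exists u, ev (in_alg D) a e u.
Proof.
move=> /evalMxP hw; have [_ _ /(_ e) [_ +] _] := ffa.
case E: (evalA a e) => [u|]; first by move=> _; exists u; apply/revalP.
by case=> //; exists m, p; rewrite hw.
Qed.

Lemma free_field_zero (m : nat) (p : V -> 'M[Kt K]_m.+1) (e : rexpr K V) w :
  ev (in_alg D) a e 0 -> ev (fun c => (frac_const c)%:M) p e w -> w = 0.
Proof.
move=> /revalP h0 /evalMxP hw; have [_ _ _ /(_ e 0 h0) [h _]] := ffa.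
exact: (h erefl m p).
Qed.

Lemma ev_frac (m : nat) (p : V -> 'M[K]_m.+1) (e : rexpr K V) w :
  ev (fun c => c%:M) p e w ->
  ev (fun c => (frac_const c)%:M) (fun v => map_mx (@frac_const K) (p v)) e
     (map_mx (@frac_const K) w).
Proof.
apply: (ev_hom (th := map_mx (@frac_const K))) => // c.
by rewrite /= map_scalar_mx.
Qed.

Lemma free_field_def_const (m : nat) (p : V -> 'M[K]_m.+1) (e : rexpr K V) w :
  ev (fun c => c%:M) p e w -> exists u, ev (in_alg D) a e u.
Proof. by move=> /ev_frac; exact: free_field_def. Qed.

Lemma free_field_zero_const (m : nat) (p : V -> 'M[K]_m.+1) (e : rexpr K V) w :
  ev (in_alg D) a e 0 -> ev (fun c => c%:M) p e w -> w = 0.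
Proof.
move=> h /ev_frac /(free_field_zero h) /eqP; rewrite map_mx_eq0 => /eqP //.
Qed.

End FreeField.

(** * Quasideterminants and coordinates *)

Section SchurBlock.
Variables (S : nzRingType) (k : nat).
Variables (U U' : 'M[S]_1) (v : 'M[S]_(1, k)) (w : 'M[S]_(k, 1)) (Z s : 'M[S]_k).
Hypotheses (UU' : U *m U' = 1%:M) (U'U : U' *m U = 1%:M).
Hypotheses (Zs : (Z - w *m U' *m v) *m s = 1%:M).
Hypotheses (sZ : s *m (Z - w *m U' *m v) = 1%:M).

Definition schur_inv : 'M[S]_(1 + k) :=
  block_mx (U' + U' *m (v *m s *m w *m U')) (- (U' *m (v *m s)))
           (- (s *m w *m U')) s.

Lemma schur_invr : block_mx U v w Z *m schur_inv = 1%:M.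
Proof.
have Zs' : Z *m s = 1%:M + w *m U' *m v *m s.
  by move/eqP: Zs; rewrite mulmxBl subr_eq => /eqP.
rewrite /schur_inv mulmx_block [RHS]scalar_mx_block; congr block_mx.
- rewrite mulmxDr !mulmxA UU' mul1mx mulmxN !mulmxA.
  by rewrite addrK.
- by rewrite mulmxN !mulmxA UU' mul1mx addNr.
- by rewrite mulmxDr mulmxN !mulmxA Zs' !mulmxDl !mul1mx ?mulmxA subrr.
- by rewrite mulmxN !mulmxA Zs' addrC addrK.
Qed.

Lemma schur_invl : schur_inv *m block_mx U v w Z = 1%:M.
Proof.
have sZ' : s *m Z = 1%:M + s *m w *m U' *m v.
  by move/eqP: sZ; rewrite mulmxBr subr_eq !mulmxA => /eqP.
rewrite /schur_inv mulmx_block [RHS]scalar_mx_block; congr block_mx.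
- rewrite mulmxDl mulNmx -!mulmxA U'U !mulmxA !mulmx1.
  by rewrite addrK.
- rewrite mulmxDl mulNmx -!mulmxA sZ' !mulmxDr mulmx1 !mulmxA.
  by rewrite subrr.
- by rewrite mulNmx -!mulmxA U'U mulmx1 addNr.
- by rewrite mulNmx ?mulmxA sZ' addrC addrK.
Qed.
End SchurBlock.

Section InvExpr.
Variables (K : nzRingType) (V : Type).

Definition schurE k (M : 'M[rexpr K V]_k.+1) : 'M[rexpr K V]_k :=
  \matrix_(i, j) RAdd (M (lift ord0 i) (lift ord0 j))
     (RNeg (RMul (RMul (M (lift ord0 i) ord0) (RInv (M ord0 ord0)))
                 (M ord0 (lift ord0 j)))).

(* Iterated Schur complements. *)
Fixpoint invE k : 'M[rexpr K V]_k -> 'M[rexpr K V]_k :=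
  match k with
  | 0 => fun M => M
  | k'.+1 => fun M =>
    let ui := RInv (M ord0 ord0) in
    let s := invE (schurE M) in
    let vs j := rsum xpredT (fun l => RMul (M ord0 (lift ord0 l)) (s l j)) in
    let sw i := rsum xpredT (fun l => RMul (s i l) (M (lift ord0 l) ord0)) in
    \matrix_(i, j)
      match unlift ord0 i, unlift ord0 j with
      | None, None =>
          RAdd ui (RMul ui (RMul (rsum xpredT (fun l => RMul (vs l) (M (lift ord0 l) ord0))) ui))
      | None, Some j' => RNeg (RMul ui (vs j'))
      | Some i', None => RNeg (RMul (sw i') ui)
      | Some i', Some j' => s i' j'
      end
  end.

Variables (S : nzRingType) (io : {rmorphism K -> S}) (pt : V -> S).

Definition evm m n (M : 'M[rexpr K V]_(m, n)) (x : 'M[S]_(m, n)) :=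
  forall i j, ev io pt (M i j) (x i j).

Lemma evm_fun m n (M : 'M[rexpr K V]_(m, n)) x y : evm M x -> evm M y -> x = y.
Proof. by move=> hx hy; apply/matrixP=> i j; apply: ev_fun (hx i j) (hy i j). Qed.

Lemma evm_exists m n (M : 'M[rexpr K V]_(m, n)) :
  (forall i j, exists w, ev io pt (M i j) w) -> exists x, evm M x.
Proof.
move=> h; have h2 i := fin_all_exists (h i).
have [f hf] := fin_all_exists h2.
by exists (\matrix_(i, j) f i j) => i j; rewrite mxE.
Qed.

Let bl k (x : 'M[S]_k.+1) : 'M[S]_(1 + k) := x.

Lemma evm_schurE k (M : 'M[rexpr K V]_k.+1) x (u' : S) : evm M x ->
  x ord0 ord0 * u' = 1 -> u' * x ord0 ord0 = 1 ->
  evm (schurE M) (drsubmx (bl x) - dlsubmx (bl x) *m u'%:M *m ursubmx (bl x)).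
Proof.
move=> hM h1 h2 i j; rewrite !mxE big_ord1 !mxE big_ord1 !mxE mulr1n !rshift1 !lshift0 /=.
exists (x (lift ord0 i) (lift ord0 j)), (- (x (lift ord0 i) ord0 * u' * x ord0 (lift ord0 j))).
split=> //; exists (x (lift ord0 i) ord0 * u' * x ord0 (lift ord0 j)) => //.
exists (x (lift ord0 i) ord0 * u'), (x ord0 (lift ord0 j)); split=> //.
exists (x (lift ord0 i) ord0), u'; split=> //.
by exists (x ord0 ord0).
Qed.

Lemma evm_invE k (M : 'M[rexpr K V]_k.+1) x (u' : S) s : evm M x ->
  x ord0 ord0 * u' = 1 -> u' * x ord0 ord0 = 1 ->
  evm (invE (schurE M)) s ->
  evm (invE M) (schur_inv u'%:M (ursubmx (bl x)) (dlsubmx (bl x)) s).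
Proof.
move=> hM h1 h2 hs.
have hu : ev io pt (RInv (M ord0 ord0)) u' by exists (x ord0 ord0).
have hvs j : ev io pt (rsum xpredT (fun l => RMul (M ord0 (lift ord0 l)) (invE (schurE M) l j)))
    ((ursubmx (bl x) *m s) ord0 j).
  rewrite mxE; apply: ev_rsum => l _; exists (x ord0 (lift ord0 l)), (s l j).
  by rewrite !mxE rshift1 lshift0.
have hsw i : ev io pt (rsum xpredT (fun l => RMul (invE (schurE M) i l) (M (lift ord0 l) ord0)))
    ((s *m dlsubmx (bl x)) i ord0).
  rewrite mxE; apply: ev_rsum => l _; exists (s i l), (x (lift ord0 l) ord0).
  by rewrite !mxE rshift1 lshift0.
have e0 : ord0 = lshift k ord0 :> 'I_(1 + k) by apply: val_inj.
have eS l : lift ord0 l = rshift 1 l :> 'I_(1 + k) by rewrite rshift1.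
set H := schur_inv _ _ _ _.
have Hdr i' j' : H (lift ord0 i') (lift ord0 j') = s i' j'.
  by rewrite !eS block_mxEdr.
have Hdl i' : H (lift ord0 i') ord0 = - ((s *m dlsubmx (bl x)) i' ord0 * u').
  by rewrite eS e0 block_mxEdl mxE [in LHS]mxE big_ord1 [_%:M _ _]mxE mulr1n.
have Hur j' : H ord0 (lift ord0 j') = - (u' * (ursubmx (bl x) *m s) ord0 j').
  by rewrite eS e0 block_mxEur mxE [in LHS]mxE big_ord1 [_%:M _ _]mxE mulr1n.
pose q := (ursubmx (bl x) *m s *m dlsubmx (bl x)) ord0 ord0.
have Hul : H ord0 ord0 = u' + u' * (q * u').
  rewrite e0 block_mxEul mxE [u'%:M _ _]mxE mulr1n; congr (_ + _).
  rewrite [LHS]mxE big_ord1 [u'%:M _ _]mxE mulr1n; congr (_ * _).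
  by rewrite [LHS]mxE big_ord1 [u'%:M _ _]mxE mulr1n.
move=> i j; rewrite mxE.
case: (unliftP ord0 i) => [i'|] ->; case: (unliftP ord0 j) => [j'|] ->.
- by rewrite Hdr.
- rewrite Hdl; exists ((s *m dlsubmx (bl x)) i' ord0 * u') => //.
  by exists ((s *m dlsubmx (bl x)) i' ord0), u'.
- rewrite Hur; exists (u' * (ursubmx (bl x) *m s) ord0 j') => //.
  by exists u', ((ursubmx (bl x) *m s) ord0 j').
- rewrite Hul; exists u', (u' * (q * u')); split=> //.
  exists u', (q * u'); split=> //; exists q, u'; split=> //.
  rewrite /q mxE; apply: ev_rsum => l _.
  exists ((ursubmx (bl x) *m s) ord0 l), (x (lift ord0 l) ord0); split=> //.
  by rewrite !mxE rshift1 lshift0.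
Qed.

(** Definedness of the entries already contains the invertibility of every pivot: the upper left
    entry contains the inverse of the pivot, and the lower right block is the inverse expression of
    the Schur complement. *)
Lemma invE_inv k (M : 'M[rexpr K V]_k) x h : evm M x -> evm (invE M) h ->
  x *m h = 1%:M /\ h *m x = 1%:M.
Proof.
elim: k M x h => [|k IH] M x h hM hI.
  by split; apply/matrixP; case.
have [u' [h1 h2]] : exists u', x ord0 ord0 * u' = 1 /\ u' * x ord0 ord0 = 1.
  have := hI ord0 ord0; rewrite mxE; case: unliftP => // _.
  move=> [u' [_ [[x0 [hx0 h1 h2]] _ _]]]; exists u'.
  by rewrite -(ev_fun hx0 (hM ord0 ord0)).
have [s hs] : exists s, evm (invE (schurE M)) s.
  apply: evm_exists => i j; exists (h (lift ord0 i) (lift ord0 j)).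
  by have := hI (lift ord0 i) (lift ord0 j); rewrite mxE !liftK.
have [Zs sZ] := IH _ _ _ (evm_schurE hM h1 h2) hs.
rewrite (evm_fun hI (evm_invE hM h1 h2 hs)).
have ux : ulsubmx (bl x) = (x ord0 ord0)%:M.
  by apply/matrixP=> i j; rewrite !ord1 !mxE !lshift0 mulr1n.
have hx : x = block_mx (ulsubmx (bl x)) (ursubmx (bl x)) (dlsubmx (bl x)) (drsubmx (bl x)).
  by rewrite submxK.
split; [rewrite {1}hx; apply: schur_invr|rewrite {3}hx; apply: schur_invl] => //.
- by rewrite ux -scalar_mxM h1.
- by rewrite ux -scalar_mxM h2.
Qed.

(** At the identity matrix every pivot is 1. This one point is enough to make the inverse
    expressions defined in the free skew field. *)
Lemma invE_def k (M : 'M[rexpr K V]_k) : evm M 1%:M -> evm (invE M) 1%:M.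
Proof.
elim: k M => [|k IH] M hM; first by move=> [].
have e00 : (1%:M : 'M[S]_k.+1) ord0 ord0 = 1 by rewrite mxE.
have := evm_schurE hM (u' := 1); rewrite e00 mulr1 => /(_ erefl erefl).
have -> : ursubmx (@bl k 1%:M) = 0.
  by apply/matrixP=> i j; rewrite !mxE !ord1 lshift0 rshift1.
have -> : drsubmx (@bl k 1%:M) = 1%:M.
  by apply/matrixP=> i j; rewrite !mxE !rshift1 (inj_eq lift_inj).
rewrite mulmx0 subr0 => /IH hs.
have h := evm_invE hM (u' := 1).
rewrite e00 mulr1 in h; have := h _ erefl erefl hs.
have [+ _] := invE_inv hM (h _ erefl erefl hs).
by rewrite mul1mx => ->.
Qed.

End InvExpr.

(** * Quasideterminants through inverses of submatrices *)

Section SubInverse.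
Variables (K : fieldType) (n d : nat) (D : unitAlgType K) (a : 'I_n * 'I_d -> D).

Definition sub_inverse (R0 : {set 'I_n}) (C0 : {set 'I_d}) (H : 'I_d -> 'I_n -> D) :=
  (forall l l', l \in C0 -> l' \in C0 ->
     \sum_(k in R0) H l k * a (k, l') = (l == l')%:R) /\
  (forall k k', k \in R0 -> k' \in R0 ->
     \sum_(l in C0) a (k, l) * H l k' = (k == k')%:R).

Lemma sub_inverse_mx (k : nat) (f : 'I_k -> 'I_n) (g : 'I_k -> 'I_d) (h : 'M[D]_k) :
  injective f -> injective g ->
  (\matrix_(i, j) a (f i, g j)) *m h = 1%:M ->
  h *m (\matrix_(i, j) a (f i, g j)) = 1%:M ->
  exists2 H, sub_inverse [set f i | i : 'I_k] [set g i | i : 'I_k] H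
    & forall i j, H (g i) (f j) = h i j.
Proof.
move=> fi gi xh hx.
(* The entries of [h] placed at the positions given by [g] and [f], and zero elsewhere. *)
pose H l r := \sum_i \sum_j h i j *+ (l == g i) *+ (r == f j).
have Hgf i j : H (g i) (f j) = h i j.
  rewrite /H (bigD1 i) //= (bigD1 j) //= !eqxx !mulr1n big1 ?addr0 => [|j' nj].
    rewrite big1 ?addr0 // => i' ni; apply: big1 => j' _.
    by rewrite (inj_eq gi) eq_sym (negPf ni) mulr0n mul0rn.
  by rewrite (inj_eq fi) [j == _]eq_sym (negPf nj) mulr0n.
exists H => //; split=> [_ _ /imsetP[i _ ->] /imsetP[j _ ->]|_ _ /imsetP[i _ ->] /imsetP[j _ ->]].
  rewrite big_imset /=; last by move=> ? ? _ _; exact: fi.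
  move/matrixP/(_ i j): hx; rewrite !mxE (inj_eq gi) => <-.
  by apply: eq_big => // l _; rewrite Hgf mxE.
rewrite big_imset /=; last by move=> ? ? _ _; exact: gi.
move/matrixP/(_ i j): xh; rewrite !mxE (inj_eq fi) => <-.
by apply: eq_big => // l _; rewrite Hgf mxE.
Qed.

Hypothesis ffa : free_field a.

Lemma free_inverse_mx (k : nat) (f : 'I_k -> 'I_n) (g : 'I_k -> 'I_d) :
  injective f -> injective g ->
  exists h, evm (in_alg D) a (invE (\matrix_(i, j) RVar K (f i, g j))) h /\
    (\matrix_(i, j) a (f i, g j)) *m h = 1%:M /\
    h *m (\matrix_(i, j) a (f i, g j)) = 1%:M.
Proof.
move=> fi gi.
(* At this point with values in 1 by 1 matrices, the selected submatrix is the identity. *)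
pose p (x : 'I_n * 'I_d) : 'M[K]_1 := [exists i, x == (f i, g i)]%:R.
have hp : evm (@scalar_mx K 1) p (\matrix_(i, j) RVar K (f i, g j)) 1%:M.
  move=> i j; rewrite !mxE /= /p; congr ((_ : bool)%:R).
  apply/idP/existsP => [/eqP ->|[l /eqP[/fi -> /gi ->]]]; last exact: eqxx.
  by exists j.
have hI := invE_def hp.
have [h hh] : exists h, evm (in_alg D) a (invE (\matrix_(i, j) RVar K (f i, g j))) h.
  apply: evm_exists => i j; have hij := hI i j.
  exact (free_field_def_const ffa hij).
exists h; split=> //; apply: invE_inv hh.
by move=> i j; rewrite !mxE.
Qed.

Lemma free_sub_inverse (R0 : {set 'I_n}) (C0 : {set 'I_d}) :
  #|R0| = #|C0| -> exists H, sub_inverse R0 C0 H.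
Proof.
move=> e; pose f (i : 'I_#|C0|) : 'I_n := enum_val (cast_ord (esym e) i).
pose g (i : 'I_#|C0|) : 'I_d := enum_val i.
have fi : injective f by move=> i j /enum_val_inj /cast_ord_inj.
have gi : injective g by exact: enum_val_inj.
have [h [_ [xh hx]]] := free_inverse_mx fi gi.
have [H hH _] := sub_inverse_mx fi gi xh hx.
have fR : [set f i | i : 'I__] = R0.
  apply/setP=> x; apply/imsetP/idP => [[i _ ->]|xR]; first exact: enum_valP.
  exists (cast_ord e (enum_rank_in xR x)) => //.
  by rewrite /f cast_ordK enum_rankK_in.
have gC : [set g i | i : 'I__] = C0.
  apply/setP=> x; apply/imsetP/idP => [[i _ ->]|xR]; first exact: enum_valP.
  by exists (enum_rank_in xR x) => //; rewrite /g enum_rankK_in.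
by exists H; move: hH; rewrite fR gC.
Qed.

Lemma qplucker_of_inverse (M : {set 'I_n}) (i j : 'I_n) G :
  #|M| = d.-1 -> i \notin M -> sub_inverse (i |: M) setT G ->
  forall s, qplucker_rel a M i j s (\sum_l a (j, l) * G l i).
Proof.
move=> cM iM [Gl Gr] s.
have [H [Hl Hr]] : exists H, sub_inverse M [set l | l != s] H.
  apply: free_sub_inverse; rewrite cM.
  have -> : [set l | l != s] = ~: [set s] by apply/setP=> x; rewrite !inE.
  by rewrite cardsC1 card_ord.
pose q (w : 'I_d -> D) := w s - \sum_(k in M) \sum_(l | l != s) w l * H l k * a (k, s).
have Hl' l l' : l != s -> l' != s -> \sum_(k in M) H l k * a (k, l') = (l == l')%:R.
  by move=> h1 h2; apply: Hl; rewrite inE.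
have Hr' k k' : k \in M -> k' \in M -> \sum_(l | l != s) a (k, l) * H l k' = (k == k')%:R.
  by move=> h1 h2; rewrite -(Hr _ _ h1 h2); apply: eq_bigl => l; rewrite inE.
have qrel x : qdet_rel a M x s (q (fun l => a (x, l))) by exists H.
have qM k : k \in M -> q (fun l => a (k, l)) = 0.
  move=> kM; rewrite /q (bigD1 k) //= -mulr_suml Hr' // eqxx mul1r big1 ?addr0 ?subrr //.
  by move=> k' /andP[k'M nk]; rewrite -mulr_suml Hr' // eq_sym (negPf nk) mul0r.
pose c k := \sum_l a (j, l) * G l k.
have rowj l' : a (j, l') = \sum_(k in i |: M) c k * a (k, l').
  under eq_bigr do rewrite mulr_suml.
  rewrite exchange_big /= (bigD1 l') //=.
  under eq_bigr do rewrite -mulrA.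
  rewrite -mulr_sumr Gl ?inE // eqxx mulr1 big1 ?addr0 // => l nl.
  under eq_bigr do rewrite -mulrA.
  by rewrite -mulr_sumr Gl ?inE // (negPf nl) mulr0.
have qj : q (fun l => a (j, l)) = c i * q (fun l => a (i, l)).
  have -> : q (fun l => a (j, l)) = \sum_(k in i |: M) c k * q (fun l => a (k, l)).
    rewrite /q rowj; under [RHS]eq_bigr do rewrite mulrBr.
    rewrite sumrB; congr (_ - _).
    under [RHS]eq_bigr do rewrite mulr_sumr.
    rewrite [RHS]exchange_big /=; apply: eq_bigr => k kM.
    under [RHS]eq_bigr do rewrite mulr_sumr.
    rewrite [RHS]exchange_big /=; apply: eq_bigr => l _.
    rewrite rowj -mulrA mulr_suml; apply: eq_bigr => k' _.
    by rewrite !mulrA.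
  rewrite big_setU1 //= big1 ?addr0 // => k kM.
  by rewrite qM // mulr0.
(* If [q] vanished on row [i], that row would be a combination of the rows in [M], against the
   invertibility of the rows in [i |: M]. *)
have qi : q (fun l => a (i, l)) != 0.
  apply/eqP=> q0.
  pose mu k := \sum_(l | l != s) a (i, l) * H l k.
  have rowi l' : a (i, l') = \sum_(k in M) mu k * a (k, l').
    have [->|ns] := eqVneq l' s.
      move/eqP: q0; rewrite /q subr_eq0 => /eqP ->.
      by apply: eq_bigr => k _; rewrite mulr_suml.
    under eq_bigr do rewrite mulr_suml.
    rewrite exchange_big /= (bigD1 l') //=.
    under eq_bigr do rewrite -mulrA.
    rewrite -mulr_sumr Hl' // eqxx mulr1 big1 ?addr0 // => l /andP[ls nl].
    under eq_bigr do rewrite -mulrA.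
    by rewrite -mulr_sumr Hl' // (negPf nl) mulr0.
  have iiM : i \in i |: M by rewrite setU11.
  have := Gr i i iiM iiM; rewrite eqxx.
  under eq_bigr do rewrite rowi mulr_suml.
  rewrite exchange_big /= big1 => [/esym/eqP|k kM]; first by rewrite oner_eq0.
  under eq_bigr do rewrite -mulrA.
  rewrite -mulr_sumr Gr ?setU11 ?setU1r //.
  have -> : (k == i) = false by apply: contraNF iM => /eqP <-.
  by rewrite mulr0.
have uq : q (fun l => a (i, l)) \is a GRing.unit.
  by have [h _ _ _] := ffa; exact: h.
exists (q (fun l => a (j, l))), (q (fun l => a (i, l))); split=> //.
by rewrite qj mulrK.
Qed.

Lemma qplucker_exists (M : {set 'I_n}) (i j : 'I_n) :
  #|M| = d.-1 -> i \notin M -> (0 < d)%N ->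
  exists r, forall s, qplucker_rel a M i j s r.
Proof.
move=> cM iM d0.
have [|G hG] := @free_sub_inverse (i |: M) setT.
  by rewrite cardsU1 iM cM cardsT card_ord add1n prednK.
by exists (\sum_l a (j, l) * G l i); exact: qplucker_of_inverse.
Qed.

End SubInverse.

(** * The coordinates [B = A X^-1] *)

Section Coordinates.
Variables (K : fieldType) (n d : nat) (dn : (d <= n)%N).

Definition top (i : 'I_d) : 'I_n := widen_ord dn i.

Lemma top_inj : injective top.
Proof. by move=> i j /(congr1 val) /= /val_inj. Qed.

Definition topE : 'M[rexpr K ('I_n * 'I_d)]_d := \matrix_(i, j) RVar K (top i, j).

Definition coordE (x : 'I_n * 'I_d) : rexpr K ('I_n * 'I_d) :=
  rsum xpredT (fun j => RMul (RVar K (x.1, j)) (invE topE j x.2)).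

Lemma topsetD1P (l : 'I_d) (k : 'I_n) :
  let t := ([set top i | i : 'I_d] :\ top l, top l, k) in
  (#|t.1.1| == d.-1) && (t.1.2 \notin t.1.1).
Proof.
rewrite /= setD11 andbT; have := cardsD1 (top l) [set top i | i : 'I_d].
rewrite card_imset ?card_ord; last exact: top_inj.
by rewrite imset_f //= => /(congr1 predn) /= ->.
Qed.

(** The entry of [B] in row [k] and column [l] is the coordinate [r_{kl}^M], with [M] the set of top
    rows other than [l]. *)
Definition top_index (x : 'I_n * 'I_d) : qp_index n d :=
  exist _ ([set top i | i : 'I_d] :\ top x.2, top x.2, x.1) (topsetD1P x.2 x.1).

Lemma top_index_inj : injective top_index.
Proof.
move=> [k l] [k' l'] /(congr1 val) /= [_ hl hk].
by rewrite hk; congr pair; apply: val_inj.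
Qed.

Variables (D : unitAlgType K) (a : 'I_n * 'I_d -> D).
Hypotheses (ffa : free_field a) (d0 : (0 < d)%N).

Lemma coord_exists : exists (h : 'M[D]_d) (b : 'I_n * 'I_d -> D)
    (r : qp_index n d -> D),
  [/\ (\matrix_(i, j) a (top i, j)) *m h = 1%:M
        /\ h *m (\matrix_(i, j) a (top i, j)) = 1%:M,
      forall x, b x = (Amx a *m h) x.1 x.2,
      forall x, ev (in_alg D) a (coordE x) (b x),
      forall t s, qplucker_rel a (qpM t) (qpi t) (qpj t) s (r t)
    & forall x, r (top_index x) = b x].
Proof.
have [h [hh [xh hx]]] := free_inverse_mx ffa top_inj (@inj_id 'I_d).
pose b (x : 'I_n * 'I_d) := (Amx a *m h) x.1 x.2.
(* The family [r] covers all indices; at those of the form [top_index x] its value is prescribed to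
   be the entry [b x]. *)
have /fin_all_exists [r hr] : forall t : qp_index n d, exists r,
    (forall s, qplucker_rel a (qpM t) (qpi t) (qpj t) s r) /\
    (forall x, t = top_index x -> r = b x).
  move=> t; have [/existsP[x /eqP tx]|nx] := boolP [exists x, t == top_index x].
    exists (b x); split; last by move=> y; rewrite tx => /top_index_inj ->.
    have [G hG Gh] := sub_inverse_mx top_inj (@inj_id 'I_d) xh hx.
    have -> : b x = \sum_l a (qpj t, l) * G l (qpi t).
      rewrite /b mxE tx; apply: eq_bigr => l _.
      by rewrite -[l in G l _]/(id l) Gh mxE.
    apply: qplucker_of_inverse => //.
    - by have /andP[/eqP] := valP t.
    - by have /andP[] := valP t.
    - have <- : [set id i | i : 'I_d] = setT.
        by apply/setP=> i; rewrite inE; apply/imsetP; exists i.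
      by rewrite tx /qpi /qpM /= setD1K // imset_f.
  have cM : #|qpM t| = d.-1 by have /andP[/eqP] := valP t.
  have iM : qpi t \notin qpM t by have /andP[] := valP t.
  have [r hr] := qplucker_exists ffa (qpj t) cM iM d0.
  exists r; split=> // x tx; case/negP: nx; apply/existsP; exists x.
  exact/eqP.
exists h, b, r; split=> // [[k l]|t s|x].
- rewrite /b mxE; apply: ev_rsum => j _; exists (a (k, j)), (h j l).
  by split; [|exact: hh|rewrite mxE].
- by case: (hr t).
- by case: (hr (top_index x)) => _ /(_ x erefl).
Qed.

(** When the top block is the identity, [A X^-1 = A]. Any matrix point with identity top block is
    therefore a value of the coordinates, so expressions in [B] can be tested at it. *)
Lemma coordE_std (S : nzRingType) (io : {rmorphism K -> S}) (p : 'I_n * 'I_d -> S) :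
  (forall i j, p (top i, j) = (i == j)%:R) ->
  forall x, ev io p (coordE x) (p x).
Proof.
move=> hp [k l].
have h1 : evm io p topE 1%:M by move=> i j; rewrite !mxE /= hp.
have h := invE_def h1.
have -> : p (k, l) = \sum_j p (k, j) * (1%:M : 'M_d) j l.
  rewrite (bigD1 l) //= mxE eqxx mulr1 big1 ?addr0 // => j jl.
  by rewrite mxE (negPf jl) mulr0.
by apply: ev_rsum => j _; exists (p (k, j)), ((1%:M : 'M_d) j l).
Qed.

End Coordinates.

(** * The case n = 2, d = 1 *)

Section MatrixGeneration.
Variables (K : fieldType) (N : nat).
Implicit Types (B G : 'M[K]_N.+1) (R : 'M[K]_N.+1 -> Prop).

Definition subalg_pred R :=
  [/\ forall c, R c%:M, forall x y, R x -> R y -> R (x + y)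
    & forall x y, R x -> R y -> R (x * y)].

Definition shift_mx : 'M[K]_N.+1 := \matrix_(i, j) (i == j.+1 :> nat)%:R.

Lemma shift_mxX k : shift_mx ^+ k = \matrix_(i, j) (i == j + k :> nat)%N%:R.
Proof.
elim: k => [|k IH].
  by apply/matrixP=> i j; rewrite expr0 !mxE addn0.
rewrite exprSr IH; apply/matrixP=> i j; rewrite !mxE.
under eq_bigr do rewrite !mxE -natrM mulnb.
have [ltj|gej] := ltnP j.+1 N.+1.
  rewrite (bigD1 (Ordinal ltj)) //= eqxx andbT big1 ?addr0 ?addSnnS // => l nl.
  by rewrite [_ == j.+1](_ : _ = false) ?andbF //; apply: contraNF nl => /eqP h; apply/eqP/val_inj.
rewrite big1 => [|l _]; last first.
  rewrite [l == _ :> nat](_ : _ = false) ?andbF //; apply/negP => /eqP h.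
  by have := ltn_ord l; rewrite h ltnNge gej.
case: eqP => // h; have := ltn_ord i; rewrite h.
by rewrite addnS -addSn ltnNge (leq_trans gej (leq_addr _ _)).
Qed.

Lemma mul_delta_l (A : 'M[K]_N.+1) i j x y :
  (delta_mx i j * A) x y = (x == i)%:R * A j y.
Proof.
rewrite mxE (bigD1 j) //= mxE eqxx andbT big1 ?addr0 // => l nl.
by rewrite mxE (negPf nl) andbF mul0r.
Qed.

Lemma mul_delta_r (A : 'M[K]_N.+1) i j x y :
  (A * delta_mx i j) x y = A x i * (y == j)%:R.
Proof.
rewrite mxE (bigD1 i) //= mxE eqxx /= big1 ?addr0 // => l nl.
by rewrite mxE (negPf nl) mulr0.
Qed.

(** Let [J] be the shift. Then [J^N = E_{N,0}], and [E_{N,0} B J^(N-j)] is a combination of the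
    [E_{N,l}] with [l <= j] whose coefficient at [l = j] is the corner entry of [B]. Induction on
    [j] yields every [E_{N,j}], the mirror argument every [E_{i,0}], and [E_{i,0} B E_{N,j}] is the
    corner entry times [E_{i,j}]. *)
Lemma subalg_shift B R : subalg_pred R -> B ord0 ord_max != 0 ->
  R B -> R shift_mx -> forall M, R M.
Proof.
move=> [Rc RD RM] B0 RB RJ; pose c := (B ord0 ord_max)^-1.
have RZ a x : R x -> R (a *: x) by move=> h; rewrite -mul_scalar_mx; apply: (RM).
have Rs (I : finType) (P : pred I) F : (forall i, P i -> R (F i)) -> R (\sum_(i | P i) F i).
  move=> h; elim/big_ind: _ => //.
  by rewrite -(raddf0 (@scalar_mx K N.+1)); exact: Rc.
have RX k : R (shift_mx ^+ k).
  by elim: k => [|k IH]; [exact: Rc|rewrite exprS; apply: (RM)].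
have nuE : shift_mx ^+ N = delta_mx ord_max ord0.
  apply/matrixP=> i j; rewrite shift_mxX !mxE; congr (nat_of_bool _)%:R.
  apply/eqP/andP=> [h|[/eqP -> /eqP ->]] //.
  have := ltn_ord i; rewrite h ltnS -[X in (_ <= X)%N]add0n leq_add2r leqn0 => /eqP j0.
  by split; apply/eqP/val_inj; rewrite /= ?h ?j0.
have Rnu : R (delta_mx ord_max ord0) by rewrite -nuE.
have RN j : R (delta_mx ord_max j).
  move: {2}(j : nat) (leqnn j) => k; elim: k j => [|k IH] j.
    by rewrite leqn0 => /eqP j0; have -> : j = ord0 by apply: val_inj.
  move=> jk; pose s := \sum_(l < N.+1 | (l < j)%N) (B *m shift_mx ^+ (N - j)) ord0 l *: delta_mx ord_max l : 'M[K]_N.+1.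
  have -> : delta_mx ord_max j = c *: (delta_mx ord_max ord0 * B * shift_mx ^+ (N - j) + (- 1) *: s).
    have -> : delta_mx ord_max ord0 * B * shift_mx ^+ (N - j) =
      \sum_l (B *m shift_mx ^+ (N - j)) ord0 l *: delta_mx ord_max l.
      rewrite -mulrA; apply/matrixP=> i l; rewrite summxE mul_delta_l.
      rewrite (bigD1 l) //= big1 => [|l' nl'].
        by rewrite !mxE eqxx andbT addr0 mulrC.
      by rewrite !mxE [l == _]eq_sym (negPf nl') andbF mulr0.
    rewrite (bigID (fun l : 'I_N.+1 => (l < j)%N)) /= -/s scaleN1r addrAC subrr add0r.
    have Bl l : (B *m shift_mx ^+ (N - j)) ord0 l = \sum_k0 B ord0 k0 * (k0 == l + (N - j) :> nat)%N%:R.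
      by rewrite mxE; apply: eq_bigr => k0 _; rewrite shift_mxX mxE.
    rewrite (bigD1 j) /=; last by rewrite ltnn.
    rewrite big1 ?addr0 => [|l /andP[]]; last first.
      rewrite -leqNgt => jl nl; rewrite Bl big1 ?scale0r // => k0 _.
      rewrite [_ == _](_ : _ = false) ?mulr0 //; apply/negP=> /eqP h.
      have lj : (j < l)%N by rewrite ltn_neqAle jl andbT; apply: contraNneq nl => h'; apply/eqP/val_inj.
      have := ltn_ord k0; rewrite h ltnS => h1.
      have : (j + (N - j) < l + (N - j))%N by rewrite ltn_add2r.
      by rewrite subnKC ?leq_ord // ltnNge h1.
    rewrite Bl (bigD1 ord_max) //= subnKC ?leq_ord // eqxx mulr1 big1 ?addr0.
      by rewrite scalerA /c mulVf // scale1r.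
    move=> k0 nk; rewrite [_ == _](_ : _ = false) ?mulr0 //; apply: contraNF nk => /eqP h.
    exact/eqP/val_inj.
  apply: (RZ). apply: (RD); first by apply: (RM); [apply: (RM)|].
  apply: (RZ); apply: (Rs) => l lj; apply: (RZ); apply: IH.
  by rewrite -ltnS; apply: leq_trans lj jk.
have R0 i : R (delta_mx i ord0).
  move: {2}(N - i)%N (leqnn (N - i)) => k; elim: k i => [|k IH] i.
    rewrite leqn0 subn_eq0 => h; have -> // : i = ord_max.
    by apply: val_inj; apply/eqP; rewrite eqn_leq h -ltnS ltn_ord.
  move=> ik; pose s := \sum_(l < N.+1 | (i < l)%N) (shift_mx ^+ i *m B) l ord_max *: delta_mx l ord0 : 'M[K]_N.+1.
  have -> : delta_mx i ord0 = c *: (shift_mx ^+ i * B * delta_mx ord_max ord0 + (- 1) *: s).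
    have -> : shift_mx ^+ i * B * delta_mx ord_max ord0 =
      \sum_l (shift_mx ^+ i *m B) l ord_max *: delta_mx l ord0.
      apply/matrixP=> i' l; rewrite summxE mul_delta_r.
      rewrite (bigD1 i') //= big1 => [|l' nl'].
        by rewrite !mxE eqxx addr0.
      by rewrite !mxE [i' == _]eq_sym (negPf nl') mulr0.
    rewrite (bigID (fun l : 'I_N.+1 => (i < l)%N)) /= -/s scaleN1r addrAC subrr add0r.
    have Bl l : (shift_mx ^+ i *m B) l ord_max = \sum_(k0 < N.+1) (l == k0 + i :> nat)%N%:R * B k0 ord_max.
      by rewrite mxE; apply: eq_bigr => k0 _; rewrite shift_mxX mxE.
    rewrite (bigD1 i) /=; last by rewrite ltnn.
    rewrite big1 ?addr0 => [|l /andP[]]; last first.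
      rewrite -leqNgt => jl nl; rewrite Bl big1 ?scale0r // => k0 _.
      rewrite [_ == _](_ : _ = false) ?mul0r //; apply/negP=> /eqP h.
      case/negP: nl; apply/eqP/val_inj/eqP; rewrite /= eqn_leq jl.
      by rewrite h leq_addl.
    rewrite Bl (bigD1 ord0) //= add0n eqxx mul1r big1 ?addr0.
      by rewrite scalerA /c mulVf // scale1r.
    move=> k0 nk; rewrite [_ == _](_ : _ = false) ?mul0r //; apply: contraNF nk => /eqP h.
    apply/eqP/val_inj => /=; apply/eqP; rewrite -(eqn_add2r i) add0n; exact/eqP.
  apply: (RZ); apply: (RD); first by apply: (RM); [apply: (RM)|].
  apply: (RZ); apply: (Rs) => l lj; apply: (RZ); apply: IH.
  by rewrite -ltnS; apply: leq_trans ik; rewrite ltn_sub2l // (leq_trans lj) // -ltnS.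
have RE i j : R (delta_mx i j).
  have -> : delta_mx i j = c *: (delta_mx i ord0 * B * delta_mx ord_max j).
    apply/matrixP=> x y; rewrite [RHS]mxE mul_delta_r mul_delta_l.
    by rewrite mulrA mulrCA mulrA -mulrA mulVf // mulr1 mxE -natrM mulnb.
  by apply: (RZ); apply: (RM) => //; apply: (RM).
move=> M; rewrite [M]matrix_sum_delta.
by apply: (Rs) => i _; apply: (Rs) => j _; apply: (RZ).
Qed.

Lemma subalg_conj G H R : G * H = 1 -> H * G = 1 ->
  subalg_pred R -> subalg_pred (fun M => R (G * M * H)).
Proof.
move=> GH HG [Rc RD RM]; split=> [c|x y Rx Ry|x y Rx Ry].
- have -> : G * c%:M * H = c%:M; last exact: Rc.
  have -> : G * c%:M = c%:M * G by exact: esym (comm_scalar_mx _ _).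
  by rewrite -mulrA GH mulr1.
- by rewrite mulrDr mulrDl; exact: RD.
- have -> : G * (x * y) * H = G * x * H * (G * y * H); last exact: RM.
  by rewrite !mulrA -(mulrA (G * x) H G) HG mulr1.
Qed.

(** A non-scalar [B] either has a nonzero off-diagonal entry already, or is diagonal with two
    distinct entries [B i i] and [B j j]; conjugation by [1 + E_ij] then creates the off-diagonal
    entry [B i i - B j j]. *)
Lemma noncentral_conj_entry B Y : B * Y <> Y * B ->
  exists G H i j, [/\ G * H = 1, H * G = 1, i != j & (H * B * G) i j != 0].
Proof.
move=> BY.
have [/existsP[i /existsP[j /andP[ij Bij]]]|] := boolP [exists i, exists j, (i != j) && (B i j != 0)].
  by exists 1, 1, i, j; rewrite !mulr1 mul1r.
move=> /existsPn diag.
have Bd i j : i != j -> B i j = 0.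
  move=> ij; have /existsPn/(_ j) := diag i.
  by rewrite ij /= negbK => /eqP.
have [/existsP[i /existsP[j nij]]|] := boolP [exists i, exists j, B i i != B j j]; last first.
  move=> /existsPn h; case: BY; have -> : B = (B ord0 ord0)%:M.
    apply/matrixP=> i j; rewrite [RHS]mxE; have [->|/Bd ->] := eqVneq i j; last by rewrite mulr0n.
    have /existsPn/(_ ord0) := h j; rewrite negbK mulr1n => /eqP //.
  exact: comm_scalar_mx.
have ij : i != j by apply: contraNneq nij => ->.
have ji : (j == i) = false by rewrite eq_sym (negPf ij).
pose e : 'M[K]_N.+1 := delta_mx i j.
have ee : e * e = 0.
  by apply/matrixP=> x y; rewrite mul_delta_l !mxE ji /= mulr0.
exists (1 + e), (1 - e), i, j; split=> //.
- by rewrite mulrBr mulr1 mulrDl mul1r ee addr0 addrK.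
- by rewrite mulrBl mul1r mulrDr mulr1 ee addr0 addrK.
have -> : (1 - e) * B * (1 + e) = B + B * e - (e * B + e * B * e).
  by rewrite mulrBl mul1r mulrBl !mulrDr !mulr1.
have -> : (B + B * e - (e * B + e * B * e)) i j =
    B i j + (B * e) i j - ((e * B) i j + (e * B * e) i j).
  by move: (B * e) (e * B) (e * B * e) => P Q T; rewrite !mxE.
rewrite !mul_delta_r !mul_delta_l !eqxx !mulr1 !mul1r.
by rewrite (Bd _ _ ij) (Bd j i) ?ji // addr0 add0r subr_eq0.
Qed.

Lemma noncentral_conj_corner B Y : B * Y <> Y * B ->
  exists G H, [/\ G * H = 1, H * G = 1 & (H * B * G) ord0 ord_max != 0].
Proof.
move=> /noncentral_conj_entry[G [H [i [j [GH HG ij Bij]]]]].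
have N0 : ord0 != ord_max :> 'I_N.+1.
  apply: contraNneq ij => /(congr1 val) /= N0; apply/eqP/val_inj => /=.
  have z (k : 'I_N.+1) : k = 0%N :> nat.
    by apply/eqP; rewrite -leqn0 [X in (_ <= X)%N]N0 leq_ord.
  by rewrite !z.
(* A permutation carrying the position [(i, j)] to the corner [(0, N)]. *)
have [s s0 sN] : exists2 s : 'S_N.+1, s ord0 = i & s ord_max = j.
  exists (tperm ord0 i * tperm (tperm ord0 i ord_max) j)%g.
    have ci : tperm ord0 i ord_max != i.
      by rewrite -{2}(tpermL ord0 i) (inj_eq perm_inj) eq_sym.
    have ji : j != i by rewrite eq_sym.
    by rewrite permM tpermL (tpermD ci ji).
  by rewrite permM tpermL.
have PP : perm_mx s *m perm_mx s^-1 = 1%:M :> 'M[K]_N.+1.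
  by rewrite -perm_mxM mulgV perm_mx1.
have PP' : perm_mx s^-1 *m perm_mx s = 1%:M :> 'M[K]_N.+1.
  by rewrite -perm_mxM mulVg perm_mx1.
exists (G * perm_mx s^-1), (perm_mx s * H); split.
- by rewrite !mulrA -(mulrA G) [perm_mx _ * _]PP' mulr1.
- by rewrite !mulrA -(mulrA _ H) HG mulr1 [LHS]PP.
have -> : perm_mx s * H * B * (G * perm_mx s^-1) = row_perm s (col_perm s (H * B * G)).
  by rewrite row_permE col_permE !mulmxA !mulrA.
by rewrite [row_perm _ _ _ _]mxE [col_perm _ _ _ _]mxE s0 sN.
Qed.

(* The generator is of the form 1 + (nilpotent), hence invertible, because b = a2 a1^-1 has to be defined at the point. *)
Lemma noncentral_generation B Y : B * Y <> Y * B ->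
  exists2 U, is_inv U & forall R, subalg_pred R -> R B -> R U -> forall M, R M.
Proof.
move=> /noncentral_conj_corner[G [H [GH HG Bc]]].
have [L hL] : exists L, (1 + shift_mx) * L = 1 /\ L * (1 + shift_mx) = 1.
  have J0 : shift_mx ^+ N.+1 = 0.
    rewrite shift_mxX; apply/matrixP=> i j; rewrite !mxE.
    rewrite [_ == _](_ : _ = false) //; apply/negP=> /eqP h.
    by have := ltn_ord i; rewrite h ltnNge leq_addl.
  have c : GRing.comm 1 (- shift_mx) by rewrite /GRing.comm mul1r mulr1.
  have E : 1 = (1 + shift_mx) * (\sum_(i < N.+1) 1 ^+ (N.+1.-1 - i) * (- shift_mx) ^+ i).
    by have := subrXX_comm N.+1 c; rewrite opprK expr1n exprNn J0 mulr0 subr0.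
  exists (\sum_(i < N.+1) 1 ^+ (N.+1.-1 - i) * (- shift_mx) ^+ i); split=> //.
  rewrite [RHS]E mulr_suml mulr_sumr; apply: eq_bigr => i _.
  rewrite expr1n mul1r; apply: commr_sym; apply: commrX; apply: commrN; apply: commr_sym.
  by apply: commrD; [exact: commr1|exact: commr_refl].
exists (G * (1 + shift_mx) * H).
  have [h1 h2] := hL.
  exists (G * L * H); split.
    by rewrite !mulrA -(mulrA _ H G) HG mulr1 -(mulrA G) h1 mulr1.
  by rewrite !mulrA -(mulrA _ H G) HG mulr1 -(mulrA G) h2 mulr1.
move=> R hR RB RU M.
have hR' := subalg_conj GH HG hR.
have MM M' : M' = G * (H * M' * G) * H.
  by rewrite !mulrA GH mul1r -mulrA GH mulr1.
rewrite [M]MM; apply: (subalg_shift hR' Bc) => /=; first by rewrite -MM.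
have [Rc RD RM] := hR'.
have -> : shift_mx = (1 + shift_mx) + (-1)%:M.
  by rewrite raddfN /= addrAC subrr add0r.
by apply: RD => //; exact: Rc.
Qed.
End MatrixGeneration.

(** * Rank one deformation at the corner *)

Definition corner_poly (R : nzRingType) m (B : 'M[R]_m.+1) : {poly R} :=
  char_poly (row' ord0 (col' ord0 B)).

Lemma cofactor_char_poly_mx (R : comNzRingType) m (B : 'M[R]_m.+1) :
  cofactor (char_poly_mx B) ord0 ord0 = corner_poly B.
Proof.
by rewrite /cofactor addn0 expr0 mul1r row'_col'_char_poly_mx.
Qed.

(** The parameter occurs in one entry only, so expansion along row 0 is affine in [t], with minus
    the corner cofactor as slope. *)
Lemma char_poly_corner (R : comNzRingType) m (B : 'M[R]_m.+1) t :
  char_poly (B + t *: delta_mx ord0 ord0) = char_poly B - t%:P * corner_poly B.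
Proof.
rewrite /char_poly (expand_det_row _ ord0) [X in _ = X - _](expand_det_row _ ord0).
have cof j : cofactor (char_poly_mx (B + t *: delta_mx ord0 ord0)) ord0 j = cofactor (char_poly_mx B) ord0 j.
  congr (_ * \det _); apply/matrixP=> x y; rewrite !mxE.
  by rewrite (_ : lift ord0 x == ord0 = false) // mulr0 addr0.
under eq_bigr do rewrite cof.
rewrite (bigD1 ord0) //= [in RHS](bigD1 ord0) //= -cofactor_char_poly_mx.
have -> : char_poly_mx (B + t *: delta_mx ord0 ord0) ord0 ord0 = char_poly_mx B ord0 ord0 - t%:P.
  by rewrite !mxE !eqxx !mulr1n mulr1 polyCD opprD addrA.
rewrite mulrBl addrAC; congr (_ + _ - _); apply: eq_bigr => j nj.
by rewrite !mxE (negPf nj) andbF mulr0 addr0.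
Qed.

Section CornerPerturbation.
Variables (K : fieldType) (m : nat) (B : 'M[K]_m.+1).
Local Notation chi := (char_poly B).
Local Notation rho := (corner_poly B).

Lemma corner_poly_neq0 : rho != 0.
Proof. exact/monic_neq0/char_poly_monic. Qed.

(** [chi] has degree [m+1] and [rho] degree [m]. After multiplication by [rho^N], the term in
    [chi^N] has strictly larger degree than all the others. *)
Lemma corner_transcendental (p : {poly K}) : p != 0 ->
  (map_poly (@frac_const K) p).[tofrac chi / tofrac rho] != 0.
Proof.
move=> p0; have r0 : tofrac rho != 0 by rewrite tofrac_eq0; exact: corner_poly_neq0.
pose N := (size p).-1.
have sp : size p = N.+1 by rewrite /N prednK // size_poly_gt0.
pose h := \sum_(i < N.+1) p`_i *: (chi ^+ i * rho ^+ (N - i)).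
apply/eqP=> v0.
have h0 : h = 0.
  apply/eqP; rewrite -tofrac_eq0; apply/eqP.
  have v1 := congr1 (fun x => x * tofrac rho ^+ N) v0; rewrite mul0r in v1.
  rewrite -[RHS]v1 /h rmorph_sum /=.
  rewrite (horner_coef_wide (n := N.+1)); last first.
    by rewrite size_map_poly sp.
  rewrite mulr_suml; apply: eq_bigr => i _.
  rewrite coef_map -mul_polyC !rmorphM !rmorphXn /= /frac_const -mulrA; congr (_ * _).
  have iN : (i <= N)%N by rewrite -ltnS.
  rewrite expr_div_n -mulrA; congr (_ * _).
  have -> : tofrac rho ^+ N = tofrac rho ^+ (N - i) * tofrac rho ^+ i.
    by rewrite -exprD subnK.
  by rewrite mulrC (mulfK (expf_neq0 i r0)).
have c0 : chi != 0 by exact/monic_neq0/char_poly_monic.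
have sX (q : {poly K}) k s : q != 0 -> size q = s.+1 -> size (q ^+ k) = (s * k).+1.
  move=> q0 hq; rewrite -[LHS]prednK ?size_poly_gt0 ?expf_neq0 //.
  by rewrite size_exp hq.
have sc k := sX _ k _ c0 (size_char_poly B).
have sr k := sX _ k _ corner_poly_neq0 (size_char_poly _).
have pN : p`_N != 0 by rewrite /N -lead_coefE lead_coef_eq0.
move: h0; rewrite /h big_ord_recr /= subnn mulr1 => /eqP; rewrite addrC addr_eq0 => /eqP.
move/(congr1 (fun q : {poly K} => size q)); rewrite size_scale // sc size_polyN => hs.
suff : (size (\sum_(i < N) p`_i *: (chi ^+ i * rho ^+ (N - i)))%R <= m.+1 * N)%N.
  by rewrite -hs ltnn.
apply: leq_trans (size_sum _ _ _) _; apply/bigmax_leqP => i _.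
apply: leq_trans (size_scale_leq _ _) _.
rewrite size_mul ?expf_neq0 ?corner_poly_neq0 // sc sr /= addnS.
have iN : (i <= N)%N := ltnW (ltn_ord i).
by rewrite !mulSn -addnA -mulnDr subnKC // ltn_add2r.
Qed.

Variables (V : eqType) (x1 : V).

Definition pair_pt (S : Type) (u w : S) : V -> S := fun v => if v == x1 then u else w.

Lemma pair_ptE (S S' : Type) (g : S -> S') u w v :
  g (pair_pt u w v) = pair_pt (g u) (g w) v.
Proof. by rewrite /pair_pt; case: eqP. Qed.

(* The matrix B + (chi/rho) E_00, multiplied by rho; at the parameter chi/rho the characteristic polynomial chi - t rho of B + t E_00 vanishes at 'X. *)
Definition corner_num : 'M[{poly K}]_m.+1 :=
  rho *: map_mx polyC B + chi *: delta_mx ord0 ord0.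

(** The denominator along [B + X E_00] is a polynomial in the parameter [X], nonzero because [e] is
    defined at [X = 0]. It survives the substitution of the transcendental [chi / rho], after which
    everything is rewritten over the common denominator [rho]. *)
Lemma corner_numden_neq0 (T : 'M[K]_m.+1) (e : rexpr K V) v :
  ev (fun c => c%:M) (pair_pt T (B * T)) e v ->
  (numden (@polyC K) (pair_pt (rho *: map_mx polyC T) (corner_num * map_mx polyC T))
     rho e).2 != 0.
Proof.
move=> hv.
pose P1 : V -> 'M[{poly K}]_m.+1 :=
  pair_pt (map_mx polyC T) ((map_mx polyC B + 'X *: delta_mx ord0 ord0) * map_mx polyC T).
pose q1 := (numden (@polyC K) P1 1 e).2.
have q1n : q1 != 0.
  have : (numden id (pair_pt T (B * T)) 1 e).2 != 0 by apply/numdenP; exists v.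
  rewrite (@numden_map _ _ _ _ _ (horner_eval 0) (@polyC K) _ P1 _ 1); first last.
  - by rewrite /= /horner_eval hornerC.
  - move=> x; rewrite /P1 (pair_ptE (map_mx (horner_eval 0))).
    have mT (A : 'M[K]_m.+1) : map_mx (horner_eval 0) (map_mx polyC A) = A.
      by apply/matrixP=> i j; rewrite !mxE /horner_eval hornerC.
    rewrite -[_ * map_mx _ _]/(_ *m _) map_mxM map_mxD map_mxZ !mT.
    by rewrite /= /horner_eval hornerX scale0r addr0.
  - by move=> c; rewrite /= /horner_eval hornerC.
  by rewrite /= -/q1; apply: contraNneq => ->; rewrite /horner_eval horner0.
have r0 : tofrac rho != 0 by rewrite tofrac_eq0; exact: corner_poly_neq0.
(* [phi] sends the deformation parameter to [chi / rho]; in its target ['X] is the variable of the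
   characteristic polynomial. *)
pose phi := horner_eval (tofrac chi / tofrac rho) \o map_poly (@frac_const K).
pose pF : V -> 'M[Kt K]_m.+1 := fun x => map_mx phi (P1 x).
have phi_q1 : phi q1 != 0 by exact: corner_transcendental.
have phi_c c : @frac_const K c = phi c%:P.
  by rewrite /phi /= map_polyC /horner_eval hornerC.
have phi_1 : 1 = phi 1 by exact: esym (rmorph1 _).
have E := @numden_map _ _ _ _ _ phi (@polyC K) (@frac_const K) P1 pF 1 1 e phi_c (fun=> erefl) phi_1.
have hF : exists w, ev (fun c => (frac_const c)%:M) pF e w.
  by apply/numdenP; rewrite E.
rewrite -tofrac_eq0.
set P2 := pair_pt _ _; have := @numden_map _ _ _ _ _ (@FracField.tofrac {poly K}) (@polyC K)
  (@frac_const K) P2 (fun x => map_mx (@FracField.tofrac _) (P2 x)) rho _ e (fun=> erefl) (fun=> erefl) erefl.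
move=> /(congr1 snd) /= <-; apply: numden_def; first exact: r0.
have [w hw] := hF; exists w; apply: ev_ext hw => x.
rewrite /pF /P1 /P2 (pair_ptE (map_mx phi)) (pair_ptE (map_mx (@FracField.tofrac _))).
have mT (A : 'M[K]_m.+1) : map_mx phi (map_mx polyC A) = map_mx (@FracField.tofrac _) (map_mx polyC A).
  by apply/matrixP=> i j; rewrite !mxE /phi /= map_polyC /horner_eval hornerC.
have mE : map_mx phi (delta_mx ord0 ord0) = delta_mx ord0 ord0 :> 'M_m.+1.
  exact: (map_delta_mx phi).
rewrite -[_ * map_mx _ _]/(_ *m _) -[corner_num * map_mx _ _]/(_ *m _).
rewrite !map_mxM !map_mxD !map_mxZ !mT mE map_delta_mx /= /phi /= map_polyX /horner_eval hornerX.
rewrite (pair_ptE ( *:%R (tofrac rho)^-1)); congr pair_pt.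
  by rewrite scalerA (mulVf r0) scale1r.
rewrite scalemxAl scalerDr !scalerA (mulVf r0) scale1r.
by rewrite [tofrac chi / _]mulrC.
Qed.
End CornerPerturbation.

(** * Block diagonal points and intertwiners *)

Section DiagonalBlocks.
Variables (R : nzRingType) (m : nat).

Definition diag2 (x : R) (y : 'M[R]_m.+1) : 'M[R]_m.+2 :=
  block_mx (x%:M : 'M_1) 0 0 y.

(** The same matrix typed in dimension [1 + m.+1], where the block identities apply, while [diag2]
    is typed in [m.+2] for the ring structure. *)
Let bl (x : R) (y : 'M[R]_m.+1) : 'M[R]_(1 + m.+1) := block_mx x%:M 0 0 y.

Lemma diag2D x y x' y' : diag2 (x + x') (y + y') = diag2 x y + diag2 x' y'.
Proof.
transitivity (bl x y + bl x' y'); last by [].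
by rewrite /diag2 /bl add_block_mx !addr0 raddfD.
Qed.

Lemma diag2N x y : diag2 (- x) (- y) = - diag2 x y.
Proof.
transitivity (- bl x y); last by [].
by rewrite /diag2 /bl opp_block_mx !oppr0 raddfN.
Qed.

Lemma diag2M x y x' y' : diag2 (x * x') (y * y') = diag2 x y * diag2 x' y'.
Proof.
transitivity (bl x y *m bl x' y'); last by [].
by rewrite /diag2 /bl mulmx_block !mulmx0 !mul0mx !addr0 !add0r scalar_mxM.
Qed.

Lemma diag2_1 : diag2 1 1 = 1.
Proof.
transitivity (1%:M : 'M[R]_(1 + m.+1)); last by [].
by rewrite scalar_mx_block.
Qed.

Lemma diag2_scalar c : diag2 c c%:M = c%:M.
Proof.
transitivity (c%:M : 'M[R]_(1 + m.+1)); last by [].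
by rewrite scalar_mx_block.
Qed.

Lemma diag2_injl x x' y y' : diag2 x y = diag2 x' y' -> x = x'.
Proof.
move=> h; have {}h : bl x y = bl x' y' := h.
by have [/matrixP/(_ ord0 ord0) + _ _ _] := eq_block_mx h; rewrite !mxE.
Qed.

Lemma diag2_inv x y : is_inv x -> is_inv y -> is_inv (diag2 x y).
Proof.
move=> [u [h1 h2]] [w [h3 h4]]; exists (diag2 u w).
by rewrite -!diag2M h1 h2 h3 h4 diag2_1.
Qed.

Lemma ev_diag2 (K V : Type) (io1 : K -> R) (io2 : K -> 'M[R]_m.+1) p1 p2
    (e : rexpr K V) v1 v2 :
  ev io1 p1 e v1 -> ev io2 p2 e v2 ->
  ev (fun c => diag2 (io1 c) (io2 c)) (fun v => diag2 (p1 v) (p2 v)) e (diag2 v1 v2).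
Proof.
elim: e v1 v2 => [v|c|e1 IH1 e2 IH2|e1 IH1|e1 IH1 e2 IH2|e1 IH1] v1 v2 /=.
- by move=> -> ->.
- by move=> -> ->.
- move=> [x [y [h1 h2 ->]]] [x' [y' [h1' h2' ->]]].
  by exists (diag2 x x'), (diag2 y y'); rewrite diag2D; split; [exact: IH1|exact: IH2|].
- move=> [x h1 ->] [x' h1' ->].
  by exists (diag2 x x'); [exact: IH1|rewrite diag2N].
- move=> [x [y [h1 h2 ->]]] [x' [y' [h1' h2' ->]]].
  by exists (diag2 x x'), (diag2 y y'); rewrite diag2M; split; [exact: IH1|exact: IH2|].
- move=> [x [h1 h2 h3]] [x' [h1' h2' h3']].
  exists (diag2 x x'); rewrite -!diag2M h2 h3 h2' h3' diag2_1.
  by split=> //; exact: IH1.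
Qed.

Definition unip (xi : 'cV[R]_m.+1) : 'M[R]_m.+2 := block_mx (1%:M : 'M_1) 0 xi 1%:M.

Lemma unipK xi : unip xi * unip (- xi) = 1.
Proof.
transitivity (block_mx (1%:M : 'M[R]_1) 0 xi (1%:M : 'M_m.+1) *m block_mx 1%:M 0 (- xi) 1%:M); first by [].
rewrite mulmx_block !mulmx0 !mul0mx !mulmx1 !mul1mx !addr0 add0r subrr.
by rewrite -scalar_mx_block.
Qed.

(** This turns intertwining of two different blocks into commutation inside one matrix ring. *)
Lemma unip_diag2 xi x y :
  unip xi * diag2 x y = diag2 x y * unip xi <-> xi *m x%:M = y *m xi.
Proof.
pose u : 'M[R]_(1 + m.+1) := block_mx 1%:M 0 xi 1%:M.
suff -> : (unip xi * diag2 x y = diag2 x y * unip xi) = (u *m bl x y = bl x y *m u).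
  rewrite /u /bl !mulmx_block !mulmx0 !mul0mx !mulmx1 !mul1mx !addr0 !add0r.
  by split=> [/eq_block_mx[]|->].
by [].
Qed.

End DiagonalBlocks.

(** * Substituting a matrix for the spectral variable *)

Section CornerPoint.
Variables (K : fieldType) (V : eqType) (x1 : V) (m k : nat).
Variables (B0 T0 : 'M[K]_m.+1) (B : 'M[K]_k.+1) (e : rexpr K V).
Local Notation rho := (corner_poly B0).
Local Notation ND := (numden (@polyC K)
  (pair_pt x1 (rho *: map_mx polyC T0) (corner_num B0 * map_mx polyC T0)) rho e).
Local Notation th := (map_mx (horner_mx B)).

Lemma horner_map_scalar x : th (x%:M : 'M_m.+1) = (horner_mx B x)%:M.
Proof. exact: map_scalar_mx. Qed.

Lemma scalar_mx_inv (R : nzRingType) (x : R) : is_inv x -> is_inv (x%:M : 'M_m.+1).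
Proof. exact: (is_inv_hom (@scalar_mx R m.+1)). Qed.

(** With [B] a matrix value of [b], [Gam] is the matrix [beta] of the overview with [b] replaced by
    [B], and [Phi] is the value of [e] at [(T0, Gam T0)]. Both are obtained over denominators that
    are polynomials in [B]. *)
Lemma corner_point : is_inv (horner_mx B rho) -> is_inv (horner_mx B ND.2) ->
  exists Gam Phi : 'M['M[K]_k.+1]_m.+1,
    [/\ ev (fun c => (c%:M)%:M) (pair_pt x1 (map_mx scalar_mx T0) (Gam * map_mx scalar_mx T0)) e Phi,
        (horner_mx B ND.2)%:M * Phi = th ND.1
      & (horner_mx B rho)%:M * Gam = th (corner_num B0)].
Proof.
move=> ir iq.
have [r' [r1 r2]] := scalar_mx_inv ir.
pose Gam := r' * th (corner_num B0).
have TT : th (map_mx polyC T0) = map_mx scalar_mx T0.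
  by apply/matrixP=> i j; rewrite !mxE horner_mx_C.
have hG : (horner_mx B rho)%:M * Gam = th (corner_num B0).
  by rewrite /Gam mulrA r1 mul1r.
have := @numden_spec _ _ _ _ (@polyC K) (pair_pt x1 (rho *: map_mx polyC T0) (corner_num B0 * map_mx polyC T0)) rho _ th
  (fun c => (c%:M)%:M) (pair_pt x1 (map_mx scalar_mx T0) (Gam * map_mx scalar_mx T0)) e.
move=> h; have [|||Phi hPhi qPhi] := h.
- by move=> c; have := horner_map_scalar c%:P; rewrite horner_mx_C => <-.
- move=> v /=; have -> : map_mx (horner_mx B) rho%:M = (horner_mx B rho)%:M := horner_map_scalar _.
  rewrite (pair_ptE _ th) (pair_ptE _ ( *%R _)); congr pair_pt.
    by rewrite map_mxZ TT; exact: mul_scalar_mx.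
  by rewrite mulrA hG -TT; exact: esym (map_mxM _ _ _).
- by have := scalar_mx_inv iq; rewrite -horner_map_scalar.
by exists Gam, Phi; split=> //; rewrite -horner_map_scalar.
Qed.
End CornerPoint.

Lemma flat_exists (R : nzRingType) (m k : nat) :
  exists (s : nat) (fl : {rmorphism 'M['M[R]_k.+1]_m.+1 -> 'M[R]_s.+1}),
    injective fl /\ forall c, fl (c%:M)%:M = c%:M.
Proof.
exists (flat_dim m k), (@flatmx R m k : {rmorphism _ -> _}); split; first exact: flatmx_inj.
exact: flatmx_scalar.
Qed.

(** * Invariant expressions in two variables *)

Section TwoVariables.
Variables (K : fieldType) (V : finType) (x1 x2 : V).
Hypotheses (x12 : x2 != x1) (xV : forall v, v = x1 \/ v = x2).
Variables (D : unitAlgType K) (a : V -> D).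
Hypothesis ffa : free_field a.
Variables (b f : D) (e : rexpr K V).
Hypothesis b_def : b * a x1 = a x2.
Hypothesis ef : ev (in_alg D) a e f.
Hypothesis f_inv : forall y v, is_inv y ->
  ev (in_alg D) (pair_pt x1 y (b * y)) e v -> v = f.

Definition ratioE : rexpr K V := RMul (RVar K x2) (RInv (RVar K x1)).

Lemma ev_ratioE (S : nzRingType) (io : K -> S) (p : V -> S) B :
  is_inv (p x1) -> p x2 = B * p x1 -> ev io p ratioE B.
Proof.
move=> [u [h1 h2]] hB; exists (p x2), u; split=> //.
  by exists (p x1).
by rewrite hB -mulrA h1 mulr1.
Qed.

Lemma pair_pt1 S (u w : S) : pair_pt x1 u w x1 = u.
Proof. by rewrite /pair_pt eqxx. Qed.
Lemma pair_pt2 S (u w : S) : pair_pt x1 u w x2 = w.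
Proof. by rewrite /pair_pt (negPf x12). Qed.

Lemma pair_pt_eta S (p : V -> S) : p =1 pair_pt x1 (p x1) (p x2).
Proof. by move=> v; case: (xV v) => ->; rewrite ?pair_pt1 ?pair_pt2. Qed.

Lemma ax1_inv : is_inv (a x1).
Proof.
have [|u [_ [-> h1 h2]]] := free_field_def_const ffa (p := fun _ => 1 : 'M[K]_1) (e := RInv (RVar K x1)) (w := 1).
  by exists 1; rewrite mulr1.
by exists u.
Qed.

Definition moveE (y : rexpr K V) : rexpr K V :=
  rsubst (fun v => if v == x1 then y else RMul ratioE y) e.

(** The matrix point certifies that [y] and the moved expression are defined in [D]. The value of
    [y] in [D] is nonzero because its matrix value [M] is, hence it is invertible and invariance
    applies. *)
Lemma moveE_const N (p : V -> 'M[K]_N.+1) B M y v :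
  is_inv (p x1) -> p x2 = B * p x1 ->
  ev (fun c => c%:M) p y M -> is_inv M ->
  ev (fun c => c%:M) (pair_pt x1 M (B * M)) e v ->
  ev (fun c => c%:M) p (moveE y) v /\ ev (in_alg D) a (moveE y) f.
Proof.
move=> ip hp hy iM hv.
have hF : ev (fun c => c%:M) p (moveE y) v.
  apply: ev_subst hv => z; rewrite /pair_pt; case: eqP => // _.
  by exists B, M; split=> //; exact: ev_ratioE.
split=> //.
have [u hu] := free_field_def_const ffa hF.
have [yd hyd] := free_field_def_const ffa hy.
have yd0 : yd != 0.
  apply/eqP=> y0; rewrite y0 in hyd.
  have M0 := free_field_zero_const ffa hyd hy.
  by have [w [/eqP]] := iM; rewrite M0 mul0r eq_sym oner_eq0.
have : ev (in_alg D) (pair_pt x1 yd (b * yd)) e u.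
  apply: ev_substE hu => z; rewrite /pair_pt; case: eqP => // _.
  exists b, yd; split=> //; apply: ev_ratioE => //; exact: ax1_inv.
by move=> /(f_inv (free_field_inv ffa yd0)) <-.
Qed.

(* The values at T and at its conjugate Z^-1 T Z agree by invariance, the latter being the conjugate of the former. *)
Lemma value_bicommutant N (B T Z Zi Y v : 'M[K]_N.+1) :
  B * Y <> Y * B -> is_inv T -> Z * Zi = 1 -> Zi * Z = 1 -> Z * B = B * Z ->
  ev (fun c => c%:M) (pair_pt x1 T (B * T)) e v -> Z * v = v * Z.
Proof.
move=> BY iT ZZi ZiZ ZB hv.
have [U iU gen] := noncentral_generation BY.
pose p := pair_pt x1 U (B * U).
(* [R] is the algebra of values at [p] of rational expressions; it contains [B] and [U], so every
   matrix is such a value. *)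
pose R M := exists y, ev (fun c : K => c%:M) p y M.
have p1 : is_inv (p x1) by rewrite /p pair_pt1.
have p2 : p x2 = B * p x1 by rewrite /p pair_pt1 pair_pt2.
have allR : forall M, R M.
  apply: gen; first split.
  - by move=> c; exists (RCst V c).
  - by move=> x y [ex hx] [ey hy]; exists (RAdd ex ey), x, y.
  - by move=> x y [ex hx] [ey hy]; exists (RMul ex ey), x, y.
  - by exists ratioE; apply: ev_ratioE.
  - by exists (RVar K x1); rewrite /= /p pair_pt1.
have [yT hT] := allR T; have [yZ hZ] := allR (Zi * T * Z).
have [hF1 dF1] := moveE_const p1 p2 hT iT hv.
have iT2 : is_inv (Zi * T * Z).
  have [w [h1 h2]] := iT; exists (Zi * w * Z).
  split.
    by rewrite !mulrA -(mulrA _ Z Zi) ZZi mulr1 -(mulrA Zi T w) h1 mulr1.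
  by rewrite !mulrA -(mulrA _ Z Zi) ZZi mulr1 -(mulrA Zi w T) h2 mulr1.
have hv2 : ev (fun c => c%:M) (pair_pt x1 (Zi * T * Z) (B * (Zi * T * Z))) e (Zi * v * Z).
  have := ev_conj (g := Z) (h := Zi) (fun c => esym (comm_scalar_mx c Z)) ZZi ZiZ hv.
  apply: ev_ext => z; rewrite (pair_ptE _ (fun x => Zi * x * Z)); congr pair_pt.
  have ZiB : Zi * B = B * Zi.
    by rewrite -[Zi * B]mulr1 -ZZi !mulrA -(mulrA Zi B Z) -ZB mulrA ZiZ mul1r.
  by rewrite !mulrA ZiB.
have [hF2 dF2] := moveE_const p1 p2 hZ iT2 hv2.
(* Both moved expressions have the value [f] in [D], so their difference is zero there and therefore
   at [p]. *)
have : v - Zi * v * Z = 0.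
  apply: (free_field_zero_const ffa (e := RAdd (moveE yT) (RNeg (moveE yZ))) (p := p)).
    by exists f, (- f); rewrite subrr; split=> //; exists f.
  by exists v, (- (Zi * v * Z)); split=> //; exists (Zi * v * Z).
move=> /eqP; rewrite subr_eq0 => /eqP {1}->.
by rewrite !mulrA ZZi mul1r.
Qed.

(** The equation [xi B = Gam xi] says that [unip xi] commutes with [diag2 B Gam]. By the bicommutant
    property at this block point it commutes with [diag2 F Phi], which is the conclusion. The
    non-commutation required there comes from the first block, [B X <> X B]; flattening makes the
    entries lie in [K]. *)
Lemma value_intertwine k m (X B F : 'M[K]_k.+1)
    (TT Gam Phi : 'M['M[K]_k.+1]_m.+1) (xi : 'cV['M[K]_k.+1]_m.+1) :
  B * X <> X * B -> is_inv X -> is_inv TT -> xi *m B%:M = Gam *m xi ->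
  ev (fun c => c%:M) (pair_pt x1 X (B * X)) e F ->
  ev (fun c => (c%:M)%:M) (pair_pt x1 TT (Gam * TT)) e Phi ->
  xi *m F%:M = Phi *m xi.
Proof.
move=> BXX iX iTT xiB hF hPhi.
have [s [fl [fl_inj flc]]] := flat_exists K m.+1 k.
have iT := diag2_inv iX iTT.
have flM y z : fl (y * z) = fl y * fl z := rmorphM fl y z.
have fl1 : fl 1 = 1 := rmorph1 fl.
have c1 : fl (diag2 B Gam) * fl (diag2 X 1) <> fl (diag2 X 1) * fl (diag2 B Gam).
  by rewrite -!flM => /fl_inj; rewrite -!diag2M => /diag2_injl; exact: BXX.
have c2 := is_inv_hom fl iT.
have c3 : fl (unip xi) * fl (unip (- xi)) = 1 by rewrite -flM unipK fl1.
have c4 : fl (unip (- xi)) * fl (unip xi) = 1.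
  have := unipK (- xi); rewrite opprK => h.
  by rewrite -flM h fl1.
have c5 : fl (unip xi) * fl (diag2 B Gam) = fl (diag2 B Gam) * fl (unip xi).
  by rewrite -!flM; congr (fl _); apply/unip_diag2.
have c6 : ev (fun c => c%:M) (pair_pt x1 (fl (diag2 X TT))
     (fl (diag2 B Gam) * fl (diag2 X TT))) e (fl (diag2 F Phi)).
  have hd := ev_diag2 hF hPhi.
  refine (ev_hom (th := fl) _ _ hd) => [c|z].
    by rewrite diag2_scalar flc.
  rewrite /pair_pt; case: eqP => _; first by [].
  by rewrite diag2M -flM.
have := value_bicommutant c1 c2 c3 c4 c5 c6.
by rewrite -!flM => /fl_inj /unip_diag2.
Qed.

Lemma ev_rpoly_mx N (W : Type) (p : W -> 'M[K]_N.+1) (g : {poly K}) y B :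
  ev (fun c => c%:M) p y B -> ev (fun c => c%:M) p (rpoly g y 0) (horner_mx B g).
Proof. exact: (ev_rpoly (io := @scalar_mx K N.+1)). Qed.

Definition commE : rexpr K V :=
  RAdd (RMul (RVar K x1) (RVar K x2)) (RNeg (RMul (RVar K x2) (RVar K x1))).

Lemma ev_commE (S : nzRingType) (io : K -> S) p :
  ev io p commE (p x1 * p x2 - p x2 * p x1).
Proof.
exists (p x1 * p x2), (- (p x2 * p x1)); split=> //; first by exists (p x1), (p x2).
by exists (p x2 * p x1) => //; exists (p x2), (p x1).
Qed.

(** Witnessed by [E_01] and [E_10] in dimension 2, whose commutator [diag(1, -1)] is its own
    inverse. *)
Lemma a_noncomm : is_inv (a x1 * a x2 - a x2 * a x1).
Proof.
pose X : 'M[K]_2 := delta_mx ord0 ord_max.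
pose Y : 'M[K]_2 := delta_mx ord_max ord0.
pose W : 'M[K]_2 := delta_mx ord0 ord0 - delta_mx ord_max ord_max.
have WW : W * W = 1.
  rewrite /W mulrBr !mulrBl -!mulmxE !mul_delta_mx_cond /= !mulr1n !mulr0n subr0 sub0r opprK.
  apply/matrixP=> i j; rewrite !mxE.
  by case: i j => [[|[|//]] ?] [[|[|//]] ?]; rewrite /= ?addr0 ?add0r.
have XYW : X * Y - Y * X = W by rewrite /X /Y -!mulmxE !mul_delta_mx.
have [u [c [hc h1 h2]]] : exists u, ev (in_alg D) a (RInv commE) u.
  apply: (free_field_def_const ffa (p := pair_pt x1 X Y) (w := W)).
  exists W; split=> //.
  by have := ev_commE (fun c => c%:M) (pair_pt x1 X Y); rewrite pair_pt1 pair_pt2 XYW.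
by exists u; rewrite -(ev_fun (e := commE) hc (ev_commE _ _)).
Qed.

Lemma ratioE_D : ev (in_alg D) a ratioE b.
Proof. exact: ev_ratioE ax1_inv (esym b_def). Qed.

(** [b] is transcendental over [K]: at the point [(1, C)] it takes the value [C], and [C] can be
    chosen with [g(C)] invertible. *)
Lemma poly_value_neq0 g : g != 0 -> (map_poly (in_alg D) g).[b] != 0.
Proof.
move=> g0; have hD := ev_rpoly g ratioE_D.
have [r [C [u [gu _]]]] := poly_matrix_unit g0.
apply/eqP=> z; rewrite z in hD.
have hC : ev (fun c => c%:M) (pair_pt x1 1 C) (rpoly g ratioE 0) (horner_mx C g).
  apply: ev_rpoly_mx; apply: ev_ratioE; rewrite ?pair_pt1 ?pair_pt2 ?mulr1 //.
  by exists 1; rewrite mulr1.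
have g1 := free_field_zero_const ffa hD hC.
by move: gu; rewrite g1 mul0r => /esym/eqP; rewrite oner_eq0.
Qed.

Lemma is_inv_cancel_mx (R : nzRingType) (m n : nat) (x : 'M[R]_m.+1) (y z : 'M_(m.+1, n)) :
  is_inv x -> x *m y = x *m z -> y = z.
Proof.
move=> [u [_ ux]] /(congr1 (fun w => u *m w)); rewrite !mulmxA.
by rewrite [u *m x]ux !mul1mx.
Qed.

Lemma is_inv_mul_comm (S : nzRingType) (x y : S) :
  x * y = y * x -> is_inv (x * y) -> is_inv x /\ is_inv y.
Proof.
move=> xy i; split; first exact: is_inv_comm i.
by rewrite xy in i; apply: is_inv_comm (esym xy) i.
Qed.

(** The eigenvector argument is run at matrix values [B] of [b]. If the candidate quotient differed
    from [f], the inverse of the difference would be defined at some matrix point, where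
    intertwining makes the difference zero. *)
Lemma two_var_rational : exists g k : {poly K},
  ev (in_alg D) (fun _ : unit => b)
     (RMul (rpoly g (RVar K tt) 0) (RInv (rpoly k (RVar K tt) 0))) f.
Proof.
have [m [p0 [_ [v0 [t0 [hv0 [t1 [-> t01 t10]] _]]]]]] :
    exists m (p : V -> 'M[K]_m.+1) w, ev (fun c => c%:M) p (RAdd e (RInv (RVar K x1))) w.
  have [u [h1 h2]] := ax1_inv.
  by apply: (free_field_point ffa (u := f + u)); exists f, u; split=> //; exists (a x1).
pose T0 := p0 x1; pose B0 := p0 x2 * t0.
have {}hv0 : ev (fun c => c%:M) (pair_pt x1 T0 (B0 * T0)) e v0.
  apply: ev_ext hv0 => v; rewrite pair_pt_eta /B0 -mulrA; congr pair_pt.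
  by rewrite [t0 * _]t10 mulr1.
pose rho := corner_poly B0; pose chi := char_poly B0.
pose P := pair_pt x1 (rho *: map_mx polyC T0) (corner_num B0 * map_mx polyC T0).
have q0 := corner_numden_neq0 hv0.
have [N [q Nq]] : exists N q, numden (@polyC K) P rho e = (N, q).
  by case: (numden _ _ _ _) => N q; exists N, q.
rewrite -/P -/rho Nq /= in q0.
(* From [(X - B0) xi = chi e_0] and [xi_0 = rho] follows [(rho B0 + chi E_00) xi = rho X xi]: this
   column is the eigenvector, with polynomial entries. *)
pose xi := col ord0 (\adj (char_poly_mx B0)).
have xi0 : xi ord0 ord0 = rho by rewrite !mxE cofactor_char_poly_mx.
have eigen : corner_num B0 *m xi = (rho * 'X) *: xi.
  have h : char_poly_mx B0 *m xi = chi *: delta_mx ord0 ord0.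
    rewrite -[xi]/(col ord0 _) colE mulmxA mul_mx_adj.
    by rewrite mul_scalar_mx.
  move/eqP: h; rewrite /char_poly_mx mulmxBl mul_scalar_mx subr_eq => /eqP h.
  rewrite /corner_num mulmxDl -!scalemxAl -scalerA h scalerDr -/rho addrC.
  congr (_ + _); rewrite scalerA mulrC -scalerA; congr (_ *: _).
  apply/matrixP=> i j; rewrite ord1 !mxE (bigD1 ord0) //= mxE.
  rewrite big1 ?addr0 => [|l nl]; last by rewrite mxE (negPf nl) andbF mul0r.
  by rewrite !eqxx !andbT mulrC -xi0; congr (xi _ _ * _); apply: val_inj.
(* Row 0 of [(N / q) xi = xi f] reads [(N xi)_0 = q rho f], which dictates [g] and [k]. *)
pose g := (N *m xi) ord0 ord0; pose k := rho * q.
have k0 : k != 0 by rewrite mulf_neq0 ?corner_poly_neq0.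
have kinv := free_field_inv ffa (poly_value_neq0 k0).
exists g, k.
pose gE y := rpoly g y 0 : rexpr K V; pose kE y := rpoly k y 0 : rexpr K V.
have [kv [kk1 kk2]] := kinv.
pose F := (map_poly (in_alg D) g).[b] * kv.
suff <- : F = f.
  exists ((map_poly (in_alg D) g).[b]), kv; split=> //; first exact: ev_rpoly.
  exists ((map_poly (in_alg D) k).[b]).
  split; [exact: ev_rpoly|exact: kk1|exact: kk2].
apply/eqP; apply: contraT => Ff.
have Ff0 : F - f != 0 by rewrite subr_eq0.
have [u [u1 u2]] := free_field_inv ffa Ff0.
have [w [w1 w2]] := a_noncomm.
(* A point where [E] is defined has an invertible value of [x1], an invertible value of the supposed
   nonzero difference and an invertible commutator. *)
pose E := RAdd ratioE (RAdd (RInv (RAdd (RMul (gE ratioE) (RInv (kE ratioE))) (RNeg e))) (RInv commE)).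
have [k' [p [w0 hp]]] : exists k' (p : V -> 'M[K]_k'.+1) w, ev (fun c => c%:M) p E w.
  apply: (free_field_point ffa (u := b + (u + w))).
  exists b, (u + w); split=> //; first exact: ratioE_D.
  exists u, w; split=> //.
    exists (F - f); split=> //; exists F, (- f); split=> //; last by exists f.
    exists (map_poly (in_alg D) g).[b], kv; split=> //.
      by apply: ev_rpoly; exact: ratioE_D.
    exists (map_poly (in_alg D) k).[b]; split; [|exact: kk1|exact: kk2].
    by apply: ev_rpoly; exact: ratioE_D.
  by exists (a x1 * a x2 - a x2 * a x1); split=> //; exact: ev_commE.
move: hp => [B [w3 [hB [i1 [i2 [[dd [hdd di1 di2]] [cc [hcc cc1 cc2]] _]]] _]]].
move: hdd => [s1 [s2 [[G [ki [hG [kx [hkx kx1 kx2]] s1E]]] [F' hF s2E] ddE]]].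
have [y1 [Xi [y1E [x0 [x0E X1 X2]] BE]]] := hB.
rewrite x0E in X1 X2; rewrite y1E in BE; set X := p x1 in X1 X2.
have [C CE] : exists C : 'M[K]_k'.+1, C = p x2 by exists (p x2).
have p2E : C = B * X by rewrite CE BE -mulrA X2 mulr1.
have GE : G = horner_mx B g := ev_fun (e := gE ratioE) hG (ev_rpoly_mx (y := ratioE) g hB).
have kxE : kx = horner_mx B rho * horner_mx B q.
  by rewrite -rmorphM; exact: (ev_fun (e := kE ratioE) hkx (ev_rpoly_mx (y := ratioE) k hB)).
have rq : horner_mx B rho * horner_mx B q = horner_mx B q * horner_mx B rho.
  by rewrite -!rmorphM mulrC.
have [ir iq] : is_inv (horner_mx B rho) /\ is_inv (horner_mx B q).
  by apply: is_inv_mul_comm => //; exists ki; rewrite -kxE.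
have ccE : cc = X * C - C * X.
  by rewrite CE; exact: (ev_fun (e := commE) hcc (ev_commE _ _)).
have [] := @corner_point K V x1 m k' B0 T0 B e ir; rewrite -/P -/rho Nq //=.
move=> Gam [Phi [hPhi qPhi rGam]].
pose XI := map_mx (horner_mx B) xi.
have XIE : XI *m B%:M = Gam *m XI.
  apply: (is_inv_cancel_mx (scalar_mx_inv m ir)).
  rewrite !mulmxA [_%:M *m Gam]rGam -map_mxM eigen.
  apply/matrixP=> i j; rewrite ord1 [in LHS]mxE big_ord1 !mxE eqxx mulr1n.
  rewrite (bigD1 i) //= !mxE eqxx mulr1n big1 ?addr0 => [|l nl]; last first.
    by rewrite !mxE eq_sym (negPf nl) mulr0n mul0r.
  by rewrite mulrAC !rmorphM /= horner_mx_X.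
have BXX : B * X <> X * B.
  move=> BX; have c0 : cc = 0.
    by rewrite ccE p2E mulrA -BX subrr.
  by move/eqP: cc1; rewrite c0 mul0r eq_sym oner_eq0.
have iX : is_inv X by exists Xi.
have iT0 : is_inv T0 by exists t0.
have hF2 : ev (fun c => c%:M) (pair_pt x1 X (B * X)) e F'.
  have hF3 : ev (fun c => c%:M) p e F' := hF.
  refine (ev_ext _ hF3) => z.
  have := pair_pt_eta p z; rewrite -CE p2E; exact.
have iTT := is_inv_hom (@map_mx K _ (@scalar_mx K k'.+1) m.+1 m.+1) iT0.
have XF := value_intertwine BXX iX iTT XIE hF2 hPhi.
have kF : horner_mx B q * horner_mx B rho * F' = G.
  have : (horner_mx B q)%:M *m (XI *m F'%:M) = map_mx (horner_mx B) (N *m xi).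
    by rewrite XF mulmxA [_%:M *m Phi]qPhi -map_mxM.
  move=> /matrixP/(_ ord0 ord0); rewrite mul_scalar_mx mxE [X in _ * X]mxE big_ord1.
  rewrite [XI _ _]mxE [_%:M _ _]mxE mulr1n [RHS]mxE GE mulrA => <-.
  by rewrite -xi0; congr (_ * horner_mx B (xi _ _) * _); apply: val_inj.
have kG : kx * G = G * kx by rewrite kxE GE -!rmorphM mulrC.
have kiG : ki * G = G * ki.
  by rewrite -[ki * G]mulr1 -kx1 !mulrA -(mulrA ki G) -kG !mulrA kx2 mul1r.
have FE : F' = G * ki by rewrite -kiG -kF -rq -kxE mulrA kx2 mul1r.
by move/eqP: di1; rewrite ddE s1E s2E FE subrr mul0r eq_sym oner_eq0.
Qed.
End TwoVariables.

(** * Two or more coordinates *)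

Section Cycle.
Variables (R : comNzRingType) (m : nat).

Definition cycle_mx : 'M[R]_m.+1 := \matrix_(i < m.+1, j < m.+1) (i == (j.+1 %% m.+1)%N :> nat)%:R.

Lemma cycle_mxX k : cycle_mx ^+ k = \matrix_(i < m.+1, j < m.+1) (i == ((j + k) %% m.+1)%N :> nat)%:R.
Proof.
elim: k => [|k IH].
  by apply/matrixP=> i j; rewrite expr0 !mxE addn0 modn_small.
rewrite exprSr IH; apply/matrixP=> i j; rewrite !mxE.
have lt : (j.+1 %% m.+1 < m.+1)%N by rewrite ltn_mod.
rewrite (bigD1 (Ordinal lt)) //= !mxE /= eqxx mulr1 modnDml addSnnS big1 ?addr0 // => l nl.
rewrite !mxE [l == _ :> nat](_ : _ = false) ?mulr0 //; apply: contraNF nl => /eqP h.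
exact/eqP/val_inj.
Qed.

(** The exponent [m+1-l] stands for [-l], the cycle having order dividing [m+1]; this keeps all
    exponents nonnegative. *)
Lemma cycle_mx_corner (k l : 'I_m.+1) :
  cycle_mx ^+ k * delta_mx ord0 ord0 * cycle_mx ^+ (m.+1 - l) = delta_mx k l.
Proof.
apply/matrixP=> x y; rewrite !mxE (bigD1 ord0) //= big1 ?addr0 => [|z nz]; last first.
  rewrite mxE big1 ?mul0r // => z' _; rewrite [delta_mx _ _ _ _]mxE (negPf nz) andbF.
  by rewrite mulr0.
rewrite mxE (bigD1 ord0) //= big1 ?addr0 => [|z nz]; last first.
  by rewrite [delta_mx _ _ _ _]mxE (negPf nz) mulr0.
rewrite [delta_mx _ _ _ _]mxE !eqxx mulr1 !cycle_mxX !mxE /= add0n modn_small //.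
rewrite -natrM mulnb; congr (nat_of_bool (_ && _))%:R.
have ll := ltn_ord l; have ly := ltn_ord y.
apply/eqP/eqP => [h|->]; last by rewrite subnKC ?modnn // ltnW.
apply: val_inj => /=; have [yl|ly'] := leqP l y.
  move: h; rewrite addnBA ?(ltnW ll) // addnC -addnBA // modnDl modn_small.
    by move/esym/eqP; rewrite subn_eq0 => yl'; apply/eqP; rewrite eqn_leq yl yl'.
  exact: leq_ltn_trans (leq_subr _ _) ly.
have : ((y + (m.+1 - l)) < m.+1)%N.
  have h2 : (y + (m.+1 - l) < l + (m.+1 - l))%N by rewrite ltn_add2r.
  by apply: leq_trans h2 _; rewrite subnKC // ltnW.
move=> /modn_small h'; rewrite h' in h; move/esym/eqP: h.
by rewrite addn_eq0 subn_eq0 leqNgt ll andbF.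
Qed.

Lemma corner_exp k : (delta_mx ord0 ord0 : 'M[R]_m.+1) ^+ k.+1 = delta_mx ord0 ord0.
Proof.
elim: k => [|k IH]; first by rewrite expr1.
by rewrite exprS IH -mulmxE mul_delta_mx.
Qed.

Lemma corner_exp_dim : (delta_mx ord0 ord0 : 'M[R]_m.+1) ^+ m = delta_mx ord0 ord0.
Proof.
move: corner_exp; case: (m) => [|k] h; last exact: h.
(* For [m = 0] the exponent is 0, and [E_00] is the 1 by 1 identity. *)
by apply/matrixP=> i j; rewrite !ord1 !mxE.
Qed.
End Cycle.

(** * Words that span the matrices over [K(t)] *)

Section Spanning.
Variables (K : fieldType) (m : nat) (B1 B2 : 'M[K]_m.+1) (rho : {poly K}) (J : nat).
Hypotheses (rho_monic : rho \is monic) (rho_size : size rho = m.+1) (J0 : (0 < J)%N).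

(** With [t = 1/X], the matrices [B1h], [B2h] and [Hh] are the deformed [B1], the deformed [B2] and
    [rho] of the deformed [B1], multiplied by [X], [X] and [X^m]. Their entries are polynomials in
    [X], and [Hh] is a homogenization of [rho]. *)
Let B1h : 'M[{poly K}]_m.+1 := delta_mx ord0 ord0 + 'X *: map_mx polyC B1.
Let B2h : 'M[{poly K}]_m.+1 := cycle_mx _ m + 'X *: map_mx polyC B2.
Let Hh : 'M[{poly K}]_m.+1 := \sum_(i < m.+1) (rho`_i *: 'X^(m - i)) *: B1h ^+ i.
Let wh (k l : 'I_m.+1) : 'M[{poly K}]_m.+1 := B2h ^+ k * Hh ^+ J * B2h ^+ (m.+1 - l).
Let ev0 := map_mx (horner_eval (0 : K)) : 'M[{poly K}]_m.+1 -> 'M[K]_m.+1.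

(** At [X = 0] only the leading coefficient of the monic [rho] survives in [Hh], leaving
    [E_00^m = E_00]; its [J]-th power is again [E_00] because [J > 0]. *)
Lemma ev0_wh k l : ev0 (wh k l) = delta_mx k l.
Proof.
have ev0Z p M : ev0 (p *: M) = p.[0] *: ev0 M by exact: map_mxZ.
have ev0D M N : ev0 (M + N) = ev0 M + ev0 N by exact: map_mxD.
have E1 : ev0 B1h = delta_mx ord0 ord0.
  by rewrite /B1h ev0D ev0Z hornerX scale0r addr0; exact: map_delta_mx.
have E2 : ev0 B2h = cycle_mx _ m.
  rewrite /B2h ev0D ev0Z hornerX scale0r addr0.
  by apply/matrixP=> i j; rewrite !mxE /horner_eval hornerMn hornerC.
have evX (M : 'M[{poly K}]_m.+1) p : ev0 (M ^+ p) = ev0 M ^+ p.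
  exact: (rmorphXn (map_mx (horner_eval (0 : K)))).
have EH : ev0 Hh = delta_mx ord0 ord0.
  rewrite /Hh /ev0 map_mx_sum big_ord_recr /= subnn expr0.
  have -> : rho`_m = 1.
    by move/monicP: rho_monic; rewrite lead_coefE rho_size.
  rewrite !scale1r -/ev0 evX E1 corner_exp_dim big1 ?add0r // => i _.
  rewrite -/ev0 ev0Z hornerZ hornerXn expr0n.
  by rewrite subn_eq0 leqNgt ltn_ord /= mulr0 scale0r.
have evM (M N : 'M[{poly K}]_m.+1) : ev0 (M * N) = ev0 M * ev0 N.
  exact: (rmorphM (map_mx (horner_eval (0 : K)))).
rewrite /wh !evM !evX E2 EH -(prednK J0) corner_exp.
exact: cycle_mx_corner.
Qed.

Let coordmx (R : comNzRingType) (w : 'I_m.+1 -> 'I_m.+1 -> 'M[R]_m.+1) :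
    'M[R]_(#|{: 'I_m.+1 * 'I_m.+1}|) :=
  \matrix_(x, y) w (enum_val x).1 (enum_val x).2 (enum_val y).1 (enum_val y).2.

(** The square matrix of coordinates of all the words specializes to the identity at [X = 0], so its
    determinant is nonzero and the words form a basis over [K(t)]. *)
Lemma wh_span (T : 'M[Kt K]_m.+1) : exists c : 'I_m.+1 -> 'I_m.+1 -> Kt K,
  T = \sum_k \sum_l c k l *: map_mx (@FracField.tofrac _) (wh k l).
Proof.
pose W := coordmx wh.
have dW : \det W != 0.
  have h : map_mx (horner_eval (0 : K)) W = 1%:M.
    apply/matrixP=> x y; rewrite !mxE -[LHS]/(horner_eval 0 _).
    have := ev0_wh (enum_val x).1 (enum_val x).2.
    move=> /matrixP/(_ (enum_val y).1 (enum_val y).2); rewrite !mxE => ->.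
    rewrite -(inj_eq enum_val_inj) [enum_val x == _]eq_sym; case: (enum_val x) (enum_val y) => x1 x2 [y1 y2].
    by rewrite xpair_eqE.
  apply/eqP => d0; have := congr1 determinant h.
  by rewrite det_map_mx d0 rmorph0 det1 => /esym/eqP; rewrite oner_eq0.
pose WF := map_mx (@FracField.tofrac _) W.
have uW : WF \in unitmx.
  by rewrite unitmxE det_map_mx unitfE tofrac_eq0.
pose tv : 'rV[Kt K]_(#|{: 'I_m.+1 * 'I_m.+1}|) := \row_x T (enum_val x).1 (enum_val x).2.
pose cv := tv *m invmx WF.
exists (fun k l => cv ord0 (enum_rank (k, l))).
have h : cv *m WF = tv by rewrite mulmxKV.
apply/matrixP=> i j; move/matrixP/(_ ord0 (enum_rank (i, j))): h.
rewrite !mxE enum_rankK => <-; rewrite pair_bigA summxE /=.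
rewrite (reindex enum_rank) /=; last first.
  by exists enum_val => x _; [exact: enum_rankK|exact: enum_valK].
by apply: eq_bigr => -[k l] _; rewrite !mxE !enum_rankK.
Qed.

(* The parameter is t = 1/'X, so that leading terms in t are read off at 'X = 0. *)
Definition tpar : Kt K := (tofrac 'X)^-1.
Definition B1t : 'M[Kt K]_m.+1 := map_mx (@frac_const K) B1 + tpar *: delta_mx ord0 ord0.
Definition B2t : 'M[Kt K]_m.+1 := map_mx (@frac_const K) B2 + tpar *: cycle_mx _ m.
Definition wt (k l : 'I_m.+1) : 'M[Kt K]_m.+1 :=
  B2t ^+ k * horner_mx B1t (map_poly (@frac_const K) rho) ^+ J * B2t ^+ (m.+1 - l).

Lemma X_neq0 : tofrac 'X != 0 :> Kt K.
Proof. by rewrite tofrac_eq0 polyX_eq0. Qed.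

Lemma wt_span (T : 'M[Kt K]_m.+1) : exists c : 'I_m.+1 -> 'I_m.+1 -> Kt K,
  T = \sum_k \sum_l c k l *: wt k l.
Proof.
have X0 := X_neq0; set u : Kt K := tofrac 'X in X0.
pose F := map_mx (@FracField.tofrac {poly K}) : 'M[{poly K}]_m.+1 -> 'M[Kt K]_m.+1.
have FX (M : 'M[{poly K}]_m.+1) p : F (M ^+ p) = F M ^+ p.
  exact: (rmorphXn (map_mx (@FracField.tofrac {poly K}))).
have FM (M N : 'M[{poly K}]_m.+1) : F (M * N) = F M * F N.
  exact: (rmorphM (map_mx (@FracField.tofrac {poly K}))).
have Fc (M : 'M[K]_m.+1) : F (map_mx polyC M) = map_mx (@frac_const K) M.
  by apply/matrixP=> i j; rewrite !mxE.
have E1 : F B1h = u *: B1t.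
  rewrite /F /B1h map_mxD map_mxZ map_delta_mx -/F Fc /B1t scalerDr scalerA.
  by rewrite /tpar (mulfV X0) scale1r addrC.
have E2 : F B2h = u *: B2t.
  rewrite /F /B2h map_mxD map_mxZ -/F Fc /B2t scalerDr scalerA.
  rewrite /tpar (mulfV X0) scale1r addrC; congr (_ + _).
  by apply/matrixP=> i j; rewrite !mxE rmorph_nat.
have EH : F Hh = u ^+ m *: horner_mx B1t (map_poly (@frac_const K) rho).
  have -> : horner_mx B1t (map_poly (@frac_const K) rho) = \sum_(i < m.+1) frac_const rho`_i *: B1t ^+ i.
    rewrite /horner_mx /horner_morph -map_poly_comp /= (horner_coef_wide (n := m.+1)); last first.
      by rewrite (leq_trans (size_poly _ _)) // rho_size.
    apply: eq_bigr => i _; rewrite coef_map_id0 ?rmorph0 //=.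
      by rewrite -mul_scalar_mx.
  have -> : F Hh = \sum_(i < m.+1) F ((rho`_i *: 'X^(m - i)) *: B1h ^+ i).
    exact: (raddf_sum (map_mx (@FracField.tofrac {poly K}))).
  rewrite scaler_sumr; apply: eq_bigr => i _.
  have im : (i <= m)%N by rewrite -ltnS.
  rewrite /F map_mxZ -/F FX E1 exprZn scalerA scalerA -mul_polyC rmorphM rmorphXn /=.
  rewrite -mulrA -exprD subnK // mulrC.
  by [].
have Ew k l : F (wh k l) = u ^+ (k + m * J + (m.+1 - l)) *: wt k l.
  rewrite /wh !FM !FX E2 EH.
  rewrite !exprZn -!scalerAl -!scalerAr !scalerA -exprM -!exprD.
  by rewrite -scalerAl scalerA -exprD addnAC.
have [c ->] := wh_span T.
exists (fun k l => c k l * u ^+ (k + m * J + (m.+1 - l))).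
apply: eq_bigr => k _; apply: eq_bigr => l _.
by rewrite -[map_mx _ _]/(F _) Ew scalerA.
Qed.
End Spanning.

(** * Avoiding zeros with powers of the parameter *)

Lemma nonroot_family (L : fieldType) (I : finType) (G : {ffun I -> L} -> L)
    (b : nat) (S : seq L) :
  uniq S -> (b <= size S)%N ->
  (forall c i, exists p : {poly L}, (size p <= b)%N /\
     forall s, G [ffun j => if j == i then s else c j] = p.[s]) ->
  forall c, G c != 0 -> exists c' : {ffun I -> L}, (forall i, c' i \in S) /\ G c' != 0.
Proof.
move=> uS bS line c Gc.
suff [c' h Gc'] : exists2 c' : {ffun I -> L}, (forall i, i \in enum I -> c' i \in S) & G c' != 0.
  by exists c'; split=> // i; apply: h; rewrite mem_enum.
elim: (enum I) => [|i s [c' h Gc']]; first by exists c.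
have [p [sp hp]] := line c' i.
(* Coordinates are replaced one at a time. Along the current line the function is a polynomial,
   nonzero at the old coordinate, so it has fewer than [b] roots and some element of [S] is not one
   of them. *)
have p0 : p != 0.
  apply: contraNneq Gc' => p0; have := hp (c' i); rewrite p0 horner0 => <-.
  by apply/eqP; congr G; apply/ffunP=> j; rewrite ffunE; case: eqP => // ->.
have /allPn[x xS px] : ~~ all (root p) S.
  apply/negP => h'; have := max_poly_roots p0 h' uS.
  by rewrite ltnNge (leq_trans sp bS).
exists [ffun j => if j == i then x else c' j]; last by rewrite hp.
move=> j; rewrite in_cons ffunE; case: eqP => //= _; exact: h.
Qed.

Section TPar.
Variable K : fieldType.

(** Multiplication by [X^N] reverses the polynomial, whose value at [X = 0] is then the leading
    coefficient of [p]. *)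
Lemma tpar_transcendental (p : {poly K}) : p != 0 ->
  (map_poly (@frac_const K) p).[tpar K] != 0.
Proof.
move=> p0; have u0 := X_neq0 K; set u : Kt K := tofrac 'X in u0.
pose N := (size p).-1.
have sp : size p = N.+1 by rewrite /N prednK // size_poly_gt0.
pose h := \sum_(i < N.+1) p`_i *: 'X^(N - i).
apply/eqP=> v0.
have h0 : h = 0.
  apply/eqP; rewrite -tofrac_eq0; apply/eqP.
  have v1 := congr1 (fun x => x * u ^+ N) v0; rewrite mul0r in v1.
  rewrite -[RHS]v1 /h rmorph_sum /=.
  rewrite (horner_coef_wide (n := N.+1)); last by rewrite size_map_poly sp.
  rewrite mulr_suml; apply: eq_bigr => i _.
  rewrite coef_map -mul_polyC !rmorphM !rmorphXn /= -mulrA; congr (_ * _).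
  have iN : (i <= N)%N by rewrite -ltnS.
  have -> : u ^+ N = u ^+ (N - i) * u ^+ i by rewrite -exprD subnK.
  by rewrite /tpar exprVn mulrC (mulfK (expf_neq0 i u0)).
have pN : p`_N != 0 by rewrite /N -lead_coefE lead_coef_eq0.
case/eqP: pN; move/(congr1 (horner^~ 0)): h0.
rewrite horner0 /h horner_sum big_ord_recr /= subnn expr0 hornerZ hornerC mulr1.
rewrite big1 ?add0r // => i _.
by rewrite hornerZ hornerXn expr0n subn_eq0 leqNgt ltn_ord mulr0.
Qed.

Lemma tpar_powers_uniq k : uniq [seq tpar K ^+ i | i <- iota 0 k].
Proof.
rewrite map_inj_uniq ?iota_uniq // => i j h; apply: contraTeq isT => ij.
have : 'X^i - 'X^j != 0 :> {poly K}.
  apply/eqP => /(congr1 (fun p : {poly K} => p`_i)).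
  by rewrite coefB !coefXn coef0 eqxx (negPf ij) subr0 => /eqP; rewrite oner_eq0.
move/tpar_transcendental; rewrite rmorphB /= !map_polyXn hornerD hornerN !hornerXn h.
by rewrite subrr eqxx.
Qed.
End TPar.

Lemma corner_cayley (K : fieldType) m (B : 'M[K]_m.+1) :
  horner_mx (B1t B) (map_poly (@frac_const K) (char_poly B)) =
  tpar K *: horner_mx (B1t B) (map_poly (@frac_const K) (corner_poly B)).
Proof.
have E : corner_poly (map_mx (@frac_const K) B) = map_poly (@frac_const K) (corner_poly B).
  by rewrite /corner_poly map_char_poly map_row' map_col'.
have := char_poly_corner (map_mx (@frac_const K) B) (tpar K).
rewrite -/(B1t B) E -map_char_poly => h.
have := Cayley_Hamilton (B1t B); rewrite h rmorphB rmorphM /= horner_mx_C.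
by move/eqP; rewrite subr_eq0 => /eqP ->; rewrite -[LHS]/(_ *m _) mul_scalar_mx.
Qed.

Definition prodpt (n d : nat) (R : nzRingType) (B : 'I_n * 'I_d -> R)
    (T : 'I_d -> 'I_d -> R) (x : 'I_n * 'I_d) : R :=
  \sum_l B (x.1, l) * T l x.2.

Lemma prodpt_map n d (R R' : nzRingType) (f : {rmorphism R -> R'})
    (B : 'I_n * 'I_d -> R) T x :
  f (prodpt B T x) = prodpt (fun y => f (B y)) (fun l j => f (T l j)) x.
Proof. by rewrite /prodpt rmorph_sum; apply: eq_bigr => l _; rewrite rmorphM. Qed.

Lemma prodpt_ext n d (R : nzRingType) (B B' : 'I_n * 'I_d -> R) T T' x :
  B =1 B' -> (forall l j, T l j = T' l j) -> prodpt B T x = prodpt B' T' x.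
Proof. by move=> hB hT; apply: eq_bigr => l _; rewrite hB hT. Qed.

(** * A point [T] given by expressions in the coordinates *)

Section GenericPoint.
Variables (K : fieldType) (n d : nat) (m : nat).
Local Notation V := ('I_n * 'I_d)%type.
Variables (e : rexpr K V) (y1 y2 : V).
Hypothesis y12 : y2 != y1.
Variables (B0 : V -> 'M[K]_m.+1) (T0 : 'I_d -> 'I_d -> 'M[K]_m.+1).
Hypothesis e_def : exists w, ev (fun c => c%:M) (prodpt B0 T0) e w.

Let chi := char_poly (B0 y1).
Let rho := corner_poly (B0 y1).

Definition genB (x : V) : 'M[Kt K]_m.+1 :=
  if x == y1 then B1t (B0 y1) else if x == y2 then B2t (B0 y2)
  else map_mx (@frac_const K) (B0 x).

(** By [numdenP], [Q T != 0] says exactly that [e] is defined at the product of the deformed point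
    and [T]. *)
Let Q (T : 'I_d -> 'I_d -> 'M[Kt K]_m.+1) : Kt K :=
  (numden (@frac_const K) (prodpt genB T) 1 e).2.

(* At t = 0 the deformation is the given point. *)
Lemma genB_start : Q (fun l j => map_mx (@frac_const K) (T0 l j)) != 0.
Proof.
pose Bp (x : V) : 'M[{poly K}]_m.+1 := map_mx polyC (B0 x) +
  ((if x == y1 then 'X *: delta_mx ord0 ord0 else if x == y2 then 'X *: cycle_mx _ m else 0)).
pose Tp l j : 'M[{poly K}]_m.+1 := map_mx polyC (T0 l j).
pose q1 := (numden (@polyC K) (prodpt Bp Tp) 1 e).2.
have q1n : q1 != 0.
  have : (numden id (prodpt B0 T0) 1 e).2 != 0 by apply/numdenP.
  have hc c : id c = horner_eval 0 (@polyC K c) by rewrite /horner_eval hornerC.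
  have h1 : 1 = horner_eval (0 : K) 1 by rewrite /horner_eval hornerC.
  have hP x : prodpt B0 T0 x = map_mx (horner_eval (0 : K)) (prodpt Bp Tp x).
    rewrite (prodpt_map (map_mx (horner_eval (0 : K)))); apply: prodpt_ext => [y|l j].
      have ev0Z p (M : 'M[{poly K}]_m.+1) : map_mx (horner_eval 0) (p *: M) = p.[0] *: map_mx (horner_eval 0) M.
        exact: map_mxZ.
      have ev0C (M : 'M[K]_m.+1) : map_mx (horner_eval 0) (map_mx polyC M) = M.
        by apply/matrixP=> i j; rewrite !mxE /horner_eval hornerC.
      rewrite /= /Bp map_mxD ev0C.
      by do 2?case: ifP => _; rewrite ?ev0Z ?hornerX ?scale0r ?raddf0 addr0.
    by apply/matrixP=> i k; rewrite /Tp /= !mxE /horner_eval hornerC.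
  rewrite (numden_map (f := horner_eval (0 : K)) e hc hP h1) /= -/q1.
  by apply: contraNneq => ->; rewrite /horner_eval horner0.
pose phi := horner_eval (tpar K) \o map_poly (@frac_const K).
have phi_q1 : phi q1 != 0 by exact: tpar_transcendental.
have phi_c c : @frac_const K c = phi c%:P.
  by rewrite /phi /= map_polyC /horner_eval hornerC.
have phi_1 : 1 = phi 1 by exact: esym (rmorph1 _).
have phiC (M : 'M[K]_m.+1) : map_mx phi (map_mx polyC M) = map_mx (@frac_const K) M.
  by apply/matrixP=> i j; rewrite !mxE phi_c.
have phiZ (M : 'M[{poly K}]_m.+1) : map_mx phi ('X *: M) = tpar K *: map_mx phi M.
  rewrite map_mxZ; congr (_ *: _).
  by rewrite /= /horner_eval map_polyX hornerX.
have hP x : prodpt genB (fun l j => map_mx (@frac_const K) (T0 l j)) x = map_mx phi (prodpt Bp Tp x).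
  rewrite (prodpt_map (map_mx phi)); apply: prodpt_ext => [y|l j].
    rewrite /genB /Bp [RHS](map_mxD phi) phiC.
    case: eqP => [->|_]; first by rewrite phiZ; congr (_ + _ *: _); rewrite (map_delta_mx phi).
    case: eqP => [->|_]; last by rewrite (raddf0 (map_mx phi)) addr0.
    rewrite phiZ; congr (_ + _ *: _).
    by apply/matrixP=> i j; rewrite !mxE; exact: esym (rmorph_nat phi _).
  by rewrite -phiC.
by rewrite /Q (numden_map (f := phi) e phi_c hP phi_1).
Qed.

Let I := ('I_d * 'I_d * ('I_m.+1 * 'I_m.+1))%type.
Let w J := wt (B0 y1) (B0 y2) rho J.
Let Tc J (c : I -> Kt K) (l j : 'I_d) : 'M[Kt K]_m.+1 :=
  \sum_k \sum_k' c (l, j, (k, k')) *: w J k k'.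

(* The degree bound does not depend on J, which is chosen afterwards. *)
Lemma generic_line : exists b, forall J c i, exists p : {poly Kt K},
  (size p <= b)%N /\
  forall s, Q (Tc J [ffun j : I => if j == i then s else c j]) = p.[s].
Proof.
have [b hb] := numden_size (Kt K) m e; exists b => J c i.
pose Cm (M : 'M[Kt K]_m.+1) := map_mx polyC M.
pose Tl l j : 'M[{poly Kt K}]_m.+1 :=
  \sum_k \sum_k' (if (l, j, (k, k')) == i then 'X else (c (l, j, (k, k')))%:P) *: Cm (w J k k').
pose io (c : K) : {poly Kt K} := (frac_const c)%:P.
pose P := prodpt (fun x => Cm (genB x)) Tl.
exists (numden io P 1 e).2; split.
  have [] // := hb io P; first by move=> x; rewrite size_polyC leq_b1.
  have ss (J' : finType) (F : J' -> {poly Kt K}) : (forall i, size (F i) <= 2)%N -> (size (\sum_i F i)%R <= 2)%N.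
    exact: size_poly_sum_bound.
  have sc (p : {poly Kt K}) x : (size p <= 2 -> size (p * x%:P)%R <= 2)%N.
    by move=> sp; rewrite mulrC mul_polyC (leq_trans (size_scale_leq _ _)).
  move=> x i' j'; rewrite summxE; apply: (ss) => l; rewrite mxE; apply: (ss) => z.
  rewrite [Cm _ _ _]mxE mulrC; apply: (sc); rewrite summxE; apply: (ss) => k.
  rewrite summxE; apply: (ss) => k'; rewrite mxE [Cm _ _ _]mxE; apply: (sc).
  by case: ifP => _; rewrite ?size_polyX // (leq_trans (size_polyC_leq1 _)).
move=> s.
have hc x : @frac_const K x = horner_eval s (io x) by rewrite /horner_eval hornerC.
have h1 : 1 = horner_eval s 1 by rewrite /horner_eval hornerC.
have evC (M : 'M[Kt K]_m.+1) : map_mx (horner_eval s) (Cm M) = M.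
  by apply/matrixP=> i' j'; rewrite !mxE /horner_eval hornerC.
have hP x : prodpt genB (Tc J [ffun j : I => if j == i then s else c j]) x = map_mx (horner_eval s) (P x).
  rewrite (prodpt_map (map_mx (horner_eval s))); apply: prodpt_ext => [y|l j].
    by rewrite /= evC.
  rewrite /Tl /= (raddf_sum (map_mx (horner_eval s))); apply: eq_bigr => k _.
  rewrite (raddf_sum (map_mx (horner_eval s))); apply: eq_bigr => k' _.
  rewrite ffunE; apply/esym; apply: etrans (map_mxZ _ _ _) _; rewrite evC; congr (_ *: _).
  by rewrite /= /horner_eval; case: ifP => _; rewrite ?hornerX ?hornerC.
by rewrite /Q (numden_map (f := horner_eval s) e hc hP h1).
Qed.

Lemma generic_point : exists (T : 'I_d -> 'I_d -> 'M[Kt K]_m.+1)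
    (hE : 'I_d -> 'I_d -> rexpr K V),
  (forall l j, ev (fun c => (frac_const c)%:M) genB (hE l j) (T l j)) /\
  exists v, ev (fun c => (frac_const c)%:M) (prodpt genB T) e v.
Proof.
(* The coefficients will be among [t^0, ..., t^b]: these exponents are at most [J], and [J] is
   positive as the spanning argument requires. *)
have [b hb] := generic_line; pose J := b.+1.
have rho_m : rho \is monic by exact: char_poly_monic.
have rho_s : size rho = m.+1 by exact: size_char_poly.
have /fin_all_exists [c hc] : forall x : 'I_d * 'I_d, exists c : 'I_m.+1 -> 'I_m.+1 -> Kt K,
    map_mx (@frac_const K) (T0 x.1 x.2) = \sum_k \sum_k' c k k' *: w J k k'.
  by move=> x; apply: wt_span.
pose c0 : {ffun I -> Kt K} := [ffun i => c i.1 i.2.1 i.2.2].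
have G0 : Q (Tc J c0) != 0.
  have hP x : prodpt genB (fun l j => map_mx (@frac_const K) (T0 l j)) x = prodpt genB (Tc J c0) x.
    apply: prodpt_ext => // l j; rewrite (hc (l, j)); apply: eq_bigr => k _.
    by apply: eq_bigr => k' _; rewrite ffunE.
  have := genB_start; rewrite /Q => h; apply/numdenP.
  have /numdenP[v hv] := h; exists v; exact: ev_ext hP hv.
have bS : (b <= size [seq tpar K ^+ i | i <- iota 0 b.+1])%N by rewrite size_map size_iota.
have [c' [c'S Gc']] := nonroot_family (G := fun c : {ffun I -> Kt K} => Q (Tc J c)) (tpar_powers_uniq K b.+1) bS (hb J) G0.
have /fin_all_exists [ex hex] : forall i, exists k, (k <= J)%N /\ c' i = tpar K ^+ k.
  move=> i; have /mapP[k] := c'S i; rewrite mem_iota add0n => /andP[_ kb] ->.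
  by exists k; split=> //; exact: ltnW.
pose V1 := RVar K y1; pose V2 := RVar K y2.
pose hE l j : rexpr K V := rsum xpredT (fun k : 'I_m.+1 => rsum xpredT (fun k' : 'I_m.+1 =>
  RMul (RMul (rexp V2 k) (RMul (rexp (rpoly chi V1 0) (ex (l, j, (k, k'))))
    (rexp (rpoly rho V1 0) (J - ex (l, j, (k, k')))))) (rexp V2 (m.+1 - k')))).
exists (Tc J c'), hE; split; last by apply/numdenP.
pose io : {rmorphism K -> 'M[Kt K]_m.+1} := @scalar_mx (Kt K) m.+1 \o @frac_const K.
have hV1 : ev io genB V1 (B1t (B0 y1)) by rewrite /= /genB eqxx.
have hV2 : ev io genB V2 (B2t (B0 y2)) by rewrite /= /genB (negPf y12) eqxx.
have hp (p : {poly K}) : ev io genB (rpoly p V1 0) (horner_mx (B1t (B0 y1)) (map_poly (@frac_const K) p)).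
  have := ev_rpoly p hV1; rewrite /horner_mx /horner_morph -map_poly_comp; exact.
move=> l j; rewrite -[fun c => _]/(io : K -> _).
apply: ev_rsum => k _; apply: ev_rsum => k' _.
have [exJ ->] := hex (l, j, (k, k')).
set H := horner_mx (B1t (B0 y1)) (map_poly (@frac_const K) rho).
have hH : ev io genB (rpoly rho V1 0) H := hp rho.
have hX : ev io genB (rpoly chi V1 0) (tpar K *: H).
  have := hp chi; rewrite corner_cayley; exact.
set x := ex _ in exJ *.
have e1 := ev_rexp k hV2; have e2 := ev_rexp x hX.
have e3 := ev_rexp (J - x) hH; have e4 := ev_rexp (m.+1 - k') hV2.
exists (B2t (B0 y2) ^+ k * ((tpar K *: H) ^+ x * H ^+ (J - x))), (B2t (B0 y2) ^+ (m.+1 - k')).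
split; [|exact: e4|].
  exists (B2t (B0 y2) ^+ k), ((tpar K *: H) ^+ x * H ^+ (J - x)).
  split; [exact: e1| |reflexivity].
  exists ((tpar K *: H) ^+ x), (H ^+ (J - x)).
  by split; [exact: e2|exact: e3|reflexivity].
rewrite exprZn /w /wt -/H -!scalerAl -exprD subnKC //.
by rewrite -scalerAr -scalerAl.
Qed.

End GenericPoint.

(** * Invariant elements *)

Section InvariantElements.
Variables (K : fieldType) (n d : nat) (D : unitAlgType K).
Local Notation V := ('I_n * 'I_d)%type.
Variables (a : V -> D) (f : D) (dn : (d <= n)%N).
Hypothesis ffa : free_field a.
Hypothesis f_inv : forall e : rexpr K V, ev (in_alg D) a e f ->
  forall g h : 'M[D]_d, g *m h = 1%:M -> h *m g = 1%:M ->
  forall v, ev (in_alg D) (fun x => (Amx a *m g) x.1 x.2) e v -> v = f.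

Variables (h : 'M[D]_d) (b : V -> D).
Let X : 'M[D]_d := \matrix_(i, j) a (top dn i, j).
Hypotheses (Xh : X *m h = 1%:M) (hX : h *m X = 1%:M).
Hypothesis b_def : forall x, b x = (Amx a *m h) x.1 x.2.
Hypothesis b_ev : forall x, ev (in_alg D) a (coordE K dn x) (b x).

Lemma coord_top i j : b (top dn i, j) = (i == j)%:R.
Proof.
rewrite b_def mxE; move/matrixP/(_ i j): Xh; rewrite !mxE => <-.
by apply: eq_bigr => l _; rewrite !mxE.
Qed.

Lemma coord_mulX x : \sum_l b (x.1, l) * X l x.2 = a x.
Proof.
transitivity ((Amx a *m h *m X) x.1 x.2).
  by rewrite [RHS]mxE; apply: eq_bigr => l _; rewrite b_def.
by rewrite -mulmxA hX mulmx1 mxE; case: x.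
Qed.

(** A guard: where a sum with this term is defined, the top block is invertible. *)
Definition inv_topE : rexpr K V :=
  rsum xpredT (fun i : 'I_d => rsum xpredT (fun j => invE (topE K dn) i j)).

Lemma inv_topE_ev (S : nzRingType) (io : {rmorphism K -> S}) p w :
  ev io p inv_topE w ->
  exists U : 'M[S]_d, evm io p (invE (topE K dn)) U /\
    (\matrix_(i, j) p (top dn i, j)) *m U = 1%:M /\
    U *m (\matrix_(i, j) p (top dn i, j)) = 1%:M.
Proof.
move=> /ev_rsumE hw.
have [U hU] : exists U, evm io p (invE (topE K dn)) U.
  apply: evm_exists => i j; have [w' hw'] := hw i.
  exact: (ev_rsumE hw' j).
exists U; split=> //; apply: invE_inv hU.
by move=> i j; rewrite !mxE.
Qed.

Lemma inv_topE_D : exists u, ev (in_alg D) a inv_topE u.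
Proof.
have [h' [hh' _]] := free_inverse_mx ffa (top_inj (dn := dn)) (@inj_id 'I_d).
by eexists; apply: ev_rsum => i _; apply: ev_rsum => j _; exact: hh'.
Qed.

(** As [y1] and [y2] lie below the top rows, the deformation leaves the identity block untouched, so
    the deformed point is still a value of the coordinates. *)
Lemma generic_invariant (y1 y2 : V) : y2 != y1 ->
  (forall i, top dn i != y1.1) -> (forall i, top dn i != y2.1) ->
  exists e', ev (in_alg D) b e' f.
Proof.
move=> y12 ny1 ny2.
have [e ef] := free_field_gen ffa f.
have [ui hui] := inv_topE_D.
pose ep := RAdd e inv_topE.
have [m [P0 [w hw]]] : exists m (p : V -> 'M[K]_m.+1) w, ev (fun c => c%:M) p ep w.
  by apply: (free_field_point ffa (u := f + ui)); exists f, ui.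
have [w1 [w2 [_ hw2 _]]] := hw.
have [U0 [_ [XU UX]]] := inv_topE_ev (io := @scalar_mx K m.+1) hw2.
(* The guard allows the matrix point to be factored as [B0 T0], with [T0] its top block. *)
pose B0 (x : V) := \sum_j P0 (x.1, j) * U0 j x.2.
pose T0 l j := P0 (top dn l, j).
have B0T0 x : P0 x = prodpt B0 T0 x.
  rewrite /prodpt /B0 /=; under eq_bigr do rewrite mulr_suml.
  rewrite exchange_big /= (bigD1 x.2) //= [X in _ + X]big1 ?addr0 => [|j nj].
    under eq_bigr do rewrite -mulrA.
    rewrite -mulr_sumr; move/matrixP/(_ x.2 x.2): UX; rewrite !mxE eqxx.
    under eq_bigr do rewrite mxE.
    by move=> ->; rewrite mulr1; case: (x).
  under eq_bigr do rewrite -mulrA.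
  rewrite -mulr_sumr; move/matrixP/(_ j x.2): UX; rewrite !mxE (negPf nj).
  under eq_bigr do rewrite mxE.
  by move=> ->; rewrite mulr0.
have B0top i j : B0 (top dn i, j) = (i == j)%:R.
  move/matrixP/(_ i j): XU; rewrite !mxE => <-.
  by apply: eq_bigr => l _; rewrite !mxE.
have [|T [hE [hT [v hv]]]] := @generic_point K n d m ep y1 y2 y12 B0 T0.
  by exists w; exact: ev_ext B0T0 hw.
have Gtop i j : genB y1 y2 B0 (top dn i, j) = (i == j)%:R.
  rewrite /genB; case: eqP => [E|_]; first by have := ny1 i; rewrite -E eqxx.
  case: eqP => [E|_]; first by have := ny2 i; rewrite -E eqxx.
  by rewrite B0top (rmorph_nat (map_mx (@frac_const K))).
pose G := genB y1 y2 B0.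
pose sub : rexpr K V -> rexpr K V :=
  rsubst (fun x => rsum xpredT (fun l => RMul (RVar K (x.1, l)) (hE l x.2))).
pose io : {rmorphism K -> 'M[Kt K]_m.+1} := @scalar_mx (Kt K) m.+1 \o @frac_const K.
(* Substituting the coordinate expressions at [G] gives back [G], so an expression defined at [G] is
   defined at [b] in [D]. *)
have toD e' u : ev io G e' u -> exists u', ev (in_alg D) b e' u'.
  move=> he'.
  have [u' hu'] : exists u', ev (in_alg D) a (rsubst (coordE K dn) e') u'.
    apply: (free_field_def ffa (p := G) (w := u)).
    apply: ev_subst he'; exact: (coordE_std io Gtop).
  exists u'; exact: ev_substE b_ev hu'.
have /fin_all_exists [H0 hH0] : forall x : 'I_d * 'I_d, exists u, ev (in_alg D) b (hE x.1 x.2) u.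
  by move=> x; exact: toD (hT x.1 x.2).
pose H l j := H0 (l, j).
pose Hm : 'M[D]_d := \matrix_(l, j) H l j.
pose y := prodpt b H.
have moved e' u : ev io (prodpt G T) e' u ->
    exists2 u', ev (in_alg D) b (sub e') u' & ev (in_alg D) y e' u'.
  move=> he'.
  have [u' hu'] : exists u', ev (in_alg D) b (sub e') u'.
    apply: (toD _ u); apply: ev_subst he' => x.
    apply: ev_rsum => l _; exists (G (x.1, l)), (T l x.2); split=> //; exact: hT.
  exists u' => //; apply: ev_substE hu' => x.
  apply: ev_rsum => l _; exists (b (x.1, l)), (H l x.2); split=> //; exact: (hH0 (l, x.2)).
(* The guard carried over to [D] shows that the top block of [y], which is [Hm], is invertible; then
   [y] is [A g] for the invertible [g = h Hm]. *)
have [v1 [v2 [hv1 hv2 _]]] := hv.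
have [u hu yu] := moved _ _ hv1.
have [u2 _ yu2] := moved _ _ hv2.
have [Hi [_ [HHi HiH]]] := inv_topE_ev (io := in_alg D) yu2.
have ytop : \matrix_(i, j) y (top dn i, j) = Hm.
  apply/matrixP=> i j; rewrite !mxE /y /prodpt /= (bigD1 i) //= coord_top eqxx mul1r.
  by rewrite big1 ?addr0 // => l nl; rewrite coord_top eq_sym (negPf nl) mul0r.
rewrite ytop in HHi HiH.
exists (sub e); suff <- : u = f by [].
apply: (f_inv ef (g := h *m Hm) (h := Hi *m X)).
- by rewrite mulmxA -(mulmxA h) HHi mulmx1.
- by rewrite mulmxA -(mulmxA Hi) Xh mulmx1.
apply: ev_ext yu => x; rewrite mulmxA [RHS]mxE; apply: eq_bigr => l _.
by rewrite b_def [Hm _ _]mxE.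
Qed.

Lemma rank_one_invariant (i0 : 'I_d) (x2 : V) : (forall i, i = i0) ->
  x2 != (top dn i0, i0) -> (forall v, v = (top dn i0, i0) \/ v = x2) ->
  exists e', ev (in_alg D) b e' f.
Proof.
move=> di x12 xV.
have [e ef] := free_field_gen ffa f.
have sumI (F : 'I_d -> D) : \sum_l F l = F i0.
  by rewrite (bigD1 i0) //= big1 ?addr0 // => l; rewrite (di l) eqxx.
have hb : b x2 * a (top dn i0, i0) = a x2.
  have := coord_mulX x2; rewrite sumI mxE (di x2.2) => <-.
  by case: (x2) => k l /=; rewrite (di l).
have hinv y v : is_inv y ->
    ev (in_alg D) (pair_pt (top dn i0, i0) y (b x2 * y)) e v -> v = f.
  move=> [z [yz zy]] hv.
  (* Here [X] is 1 by 1, and [A h y] has the two entries [y] and [b y]. *)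
  apply: (f_inv ef (g := h *m y%:M) (h := z%:M *m X)).
  - by rewrite mulmxA -(mulmxA h) -scalar_mxM yz mulmx1.
  - by rewrite mulmxA -(mulmxA _ X) Xh mulmx1 -scalar_mxM zy.
  apply: ev_ext hv => x; rewrite mulmxA mxE sumI -/(b_def _) [y%:M _ _]mxE (di x.2) eqxx mulr1n.
  have -> : (Amx a *m h) x.1 i0 = b x by rewrite b_def (di x.2).
  case: (xV x) => ->; rewrite /pair_pt ?eqxx ?(negPf x12) //.
  by rewrite coord_top eqxx mul1r.
have [g [k hgk]] := two_var_rational x12 xV ffa hb ef hinv.
eexists; apply: ev_subst hgk => u.
by instantiate (1 := fun _ => RVar K x2).
Qed.

Lemma invariant_coord : (d < n)%N -> (0 < d)%N -> exists e', ev (in_alg D) b e' f.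
Proof.
move=> dlt d0.
pose i0 : 'I_d := Ordinal d0; pose k0 : 'I_n := Ordinal dlt.
have nk i : top dn i != k0 by apply/negP => /eqP/(congr1 val) /= E; have := ltn_ord i; rewrite E ltnn.
(* Two entries below the top block lie in one row when [d >= 2] and in one column when [n >= d + 2];
   only [n = 2], [d = 1] remains. *)
have [d2|d1] := ltnP 1 d.
  by apply: (@generic_invariant (k0, i0) (k0, Ordinal d2)) => //; rewrite xpair_eqE eqxx.
have dE : d = 1%N by apply/eqP; rewrite eqn_leq d1 d0.
have [n3|n2] := ltnP d.+1 n.
  apply: (@generic_invariant (k0, i0) (Ordinal n3, i0)) => //.
    by apply/negP => /eqP/(congr1 (fun x : V => val x.1)) /= /eqP; rewrite eqn_leq ltnn.
  move=> i; apply/negP => /eqP/(congr1 val) /= E; have := ltn_ord i.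
  by rewrite E ltnNge leqnSn.
have di i : i = i0 by apply: val_inj; apply/eqP => /=; rewrite -leqn0 -ltnS -dE.
apply: (@rank_one_invariant i0 (k0, i0) di).
  by rewrite xpair_eqE negb_and eq_sym nk.
move=> [k l]; rewrite (di l); have [kd|kd] := ltnP k d.
  left; congr (_, _); apply: val_inj => /=; apply/eqP; rewrite -leqn0 -ltnS -dE //.
right; congr (_, _); apply: val_inj => /=; apply/eqP; rewrite eqn_leq kd andbT.
by rewrite -ltnS (leq_trans (ltn_ord k)).
Qed.

End InvariantElements.

Theorem mainTheorem5 (K : fieldType) (n d : nat) (D : unitAlgType K)
  (a : 'I_n * 'I_d -> D) (f : D) :
  (d < n)%N -> (0 < d)%N ->
  free_field a ->
  (forall e : rexpr K ('I_n * 'I_d), evalA a e = Some f ->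
     forall g h : 'M[D]_d, g *m h = 1%:M -> h *m g = 1%:M ->
     forall v : D, evalA (fun p : 'I_n * 'I_d => (Amx a *m g) p.1 p.2) e = Some v ->
     v = f) ->
  exists (e : rexpr K (qp_index n d)) (r : qp_index n d -> D),
    (forall (t : qp_index n d) (s : 'I_d),
        qplucker_rel a (qpM t) (qpi t) (qpj t) s (r t)) /\
    evalA r e = Some f.
Proof.
move=> dlt d0 ffa f_inv.
have dn : (d <= n)%N := ltnW dlt.
have [h [b [r [[Xh hX] b_def b_ev hr rb]]]] := coord_exists dn ffa d0.
have f_inv' (e : rexpr K ('I_n * 'I_d)) : ev (in_alg D) a e f ->
    forall g h : 'M[D]_d, g *m h = 1%:M -> h *m g = 1%:M ->
    forall v, ev (in_alg D) (fun x => (Amx a *m g) x.1 x.2) e v -> v = f.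
  by move=> /revalP he g g' gg' g'g v /revalP; exact: f_inv he g g' gg' g'g v.
have [e' he'] := invariant_coord ffa f_inv' Xh hX b_def b_ev dlt d0.
exists (rsubst (fun x => RVar K (top_index dn x)) e'), r; split=> //.
by apply/revalP; apply: ev_subst he' => x; rewrite /= rb.
Qed.
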